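(* Consider the minimization over $\mathbb{R}^d$ of $f=\frac1M\sum_{m=1}^M f_m$, where every $f_m$ is $\delta$-related to $f$ and $f$ is $\mu$-strongly convex, and let $x_*$ be its minimizer. Let $(y_k)_{k\ge 0}$, $(z_k)_{k\ge0}$ be generated by the algorithm OLGA (described in the context) with an unbiased compressor $Q$ with constant $\omega>1$ and parameters $p\in(0,1)$, $\theta>0$, $\tau\in(0,1)$, $\alpha>0$ such that $$\theta\le\min\left\{\frac{\sqrt p\,\sqrt M}{8\delta\sqrt\omega},\ \frac1{2\delta}\right\},\qquad 4\alpha p\tau\le\theta .$$ Define $$Y_k=\frac{\alpha}{\tau}\,[f(y_k)-f(x_* )],\qquad Z_k=\frac{1+\mu\alpha}{2}\,\|z_k-x_*\|^2 .$$ Then for every $k\ge 0$ $$\mathbb{E}\left[Y_{k+1}+Z_{k+1}\right]\le \mathbb{E}\left[(1-\tau)Y_k+(1+\mu\alpha)^{-1}Z_k\right].$$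
   Context: Setting: $f_1,\dots,f_M:\mathbb{R}^d\to\mathbb{R}$ are twice differentiable (in the application $f_m(x)=\frac1{n_m}\sum_{j=1}^{n_m}\ell(x,z_j^m)$ is the local loss on node $m$), $f=\frac1M\sum_{m=1}^M f_m$, node $1$ is the server. The norm is Euclidean (spectral norm for matrices). $\delta$-relatedness: $\delta>0$ and $\|\nabla^2 f_m(x)-\nabla^2 f(x)\|\le\delta$ for all $x\in\mathbb{R}^d$ and all $m$. (The $f_m$ may be non-convex.) $\mu$-strong convexity: $\mu>0$ and $f(x)\ge f(y)+\langle\nabla f(y),x-y\rangle+\frac\mu2\|x-y\|^2$ for all $x,y\in\mathbb{R}^d$. Unbiased compressor with constant $\omega>1$: a random map $Q:\mathbb{R}^d\to\mathbb{R}^d$ with $\mathbb{E}_Q[Q(x)]=x$ and $\mathbb{E}_Q[\|Q(x)-x\|^2]\le\omega\|x\|^2$ for all $x\in\mathbb{R}^d$. Every application of $Q$ (on different nodes and at different iterations) uses independent randomness, independent also of the variables $N$ below. Epoch procedure $\mathrm{Epoch}(u_0,\theta,p)$: draw $N\sim\mathrm{Geom}(p)$, i.e. $\Pr[N=n]=p(1-p)^{n-1}$ for $n=1,2,\dots$ For $j=0,1,\dots,N-1$: for each $m$ put $\hat g_j^m=\nabla f_m(u_j)-\nabla f_1(u_j)-\nabla f_m(u_0)+\nabla f_1(u_0)$ and $g_j^m=Q(\hat g_j^m)$; put $g_j=\frac1M\sum_{m=1}^M g_j^m$ and $s_j=g_j-\nabla f_1(u_0)+\nabla f(u_0)$; set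 $u_{j+1}=\arg\min_{u\in\mathbb{R}^d}\left\{\langle s_j,u-u_j\rangle+\frac1{2\theta}\|u-u_j\|^2+f_1(u)\right\}$. Output $u_N$. OLGA: input $z_0=y_0\in\mathbb{R}^d$, $p\in(0,1)$, $\theta>0$, $\tau\in(0,1)$, $\alpha>0$. For $k=0,1,2,\dots$: $x_{k+1}=\tau z_k+(1-\tau)y_k$; $y_{k+1}=\mathrm{Epoch}(x_{k+1},\theta,p)$ (with fresh randomness); $t_k=\nabla(f_1-f)(x_{k+1})-\nabla(f_1-f)(y_{k+1})$; $G_{k+1}=p\left(t_k+\frac{x_{k+1}-y_{k+1}}{\theta}\right)$; $z_{k+1}=\arg\min_{z\in\mathbb{R}^d}\left\{\frac1{2\alpha}\|z-z_k\|^2+\langle G_{k+1},z\rangle+\frac\mu2\|z-y_{k+1}\|^2\right\}$. $\mathbb{E}$ is expectation over all randomness. *)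

(* Defs.v *)
From HB Require Import structures.
From mathcomp Require Import all_boot all_order all_algebra.
From mathcomp Require Import finmap.
From mathcomp Require Import all_classical all_reals all_analysis.

Set Implicit Arguments.
Unset Strict Implicit.
Unset Printing Implicit Defensive.

Import Order.TTheory GRing.Theory Num.Theory.
Import numFieldNormedType.Exports.

Local Open Scope classical_set_scope.
Local Open Scope ring_scope.

(* Points of R^d are row vectors 'rV[R]_d.  The library norm on 'rV[R]_d is the
   sup norm; it is only used through the (equivalent) topology and
   differentiability it induces.  The norm of the mathematics is [enorm]. *)

Section Euclidean.
Context {R : realType} {d : nat}.
Implicit Types u v x : 'rV[R]_d.

Definition dotv u v : R := \sum_(i < d) u 0 i * v 0 i.

Definition enorm u : R := Num.sqrt (dotv u u).

Definition specnorm (A : 'M[R]_d) : R :=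
  sup [set enorm (v *m A) | v in [set v | enorm v <= 1]].

Definition grad (g : 'rV[R]_d -> R) x : 'rV[R]_d :=
  \row_(i < d) 'D_(delta_mx 0 i) g x.

Definition hessian (g : 'rV[R]_d -> R) x : 'M[R]_d := jacobian (grad g) x.

Definition twice_differentiable (g : 'rV[R]_d -> R) : Prop :=
  forall x, differentiable g x /\ differentiable (grad g) x.

Definition strongly_convex (mu : R) (g : 'rV[R]_d -> R) : Prop :=
  forall x y,
    g x >= g y + dotv (grad g y) (x - y) + mu / 2 * enorm (x - y) ^+ 2.

Definition is_argmin (g : 'rV[R]_d -> R) x : Prop := forall y, g x <= g y.

(* A chosen minimizer; the default point of the type if [g] has none. *)
Definition argmin (g : 'rV[R]_d -> R) : 'rV[R]_d := get (is_argmin g).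

End Euclidean.

Section Distributed.
Context {R : realType} {d M : nat}.
Variable f : 'I_M -> 'rV[R]_d -> R.

Definition avg (x : 'rV[R]_d) : R := M%:R^-1 * \sum_(m < M) f m x.

Definition related (delta : R) : Prop :=
  forall m x, specnorm (hessian (f m) x - hessian avg x) <= delta.

(* [srv] is the server node.  [q j m] is the realisation of the compressor used
   at inner iteration [j] on node [m]; [epoch_iter q theta u0 j] is u_j. *)
Variable srv : 'I_M.

Definition epoch_step (q : 'I_M -> 'rV[R]_d -> 'rV[R]_d) (theta : R)
    (u0 u : 'rV[R]_d) : 'rV[R]_d :=
  let ghat m := grad (f m) u - grad (f srv) u
                - grad (f m) u0 + grad (f srv) u0 in
  let g := M%:R^-1 *: \sum_(m < M) q m (ghat m) in
  let s := g - grad (f srv) u0 + grad avg u0 in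
  argmin (fun v => dotv s (v - u) + (2 * theta)^-1 * enorm (v - u) ^+ 2
                   + f srv v).

Fixpoint epoch_iter (q : nat -> 'I_M -> 'rV[R]_d -> 'rV[R]_d) (theta : R)
    (u0 : 'rV[R]_d) (j : nat) : 'rV[R]_d :=
  if j is j'.+1 then epoch_step (q j') theta u0 (epoch_iter q theta u0 j')
  else u0.

(* The pair (y_k, z_k) along one realisation: [q k j m] is the compressor used
   at inner iteration [j] on node [m] of the epoch that produces y_(k+1), and
   [N k] is the length of that epoch. *)
Fixpoint olga (q : nat -> nat -> 'I_M -> 'rV[R]_d -> 'rV[R]_d) (N : nat -> nat)
    (mu p theta tau alpha : R) (z0 : 'rV[R]_d) (k : nat)
    : 'rV[R]_d * 'rV[R]_d :=
  if k is k'.+1 then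
    let: (y, z) := olga q N mu p theta tau alpha z0 k' in
    let x := tau *: z + (1 - tau) *: y in
    let y' := epoch_iter (q k') theta x (N k') in
    let h w := f srv w - avg w in
    let t := grad h x - grad h y' in
    let G := p *: (t + theta^-1 *: (x - y')) in
    (y', argmin (fun w => (2 * alpha)^-1 * enorm (w - z) ^+ 2 + dotv G w
                          + mu / 2 * enorm (w - y') ^+ 2))
  else (z0, z0).

End Distributed.

Section Randomness.
Context {R : realType}.

(* A random map of R^d is a map [Q] depending on a seed of law [PS]; it is
   required to be jointly measurable (for the Borel sets of R^d), so that it may
   be applied to random vectors. *)
Definition unbiased_compressor {dS : measure_display} {S : measurableType dS}
    {d : nat} (PS : probability S R) (Q : S -> 'rV[R]_d -> 'rV[R]_d)
    (omega : R) : Prop :=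
  [/\ forall i : 'I_d, measurable_fun [set: S * g_sigma_algebraType (@open 'rV[R]_d)]
        (fun sx : S * g_sigma_algebraType (@open 'rV[R]_d) => Q sx.1 sx.2 0 i),
      forall x (i : 'I_d), ('E_PS[fun s => (Q s x 0 i)%R] = (x 0 i)%:E)%E
    & forall x, ('E_PS[fun s => (enorm (Q s x - x) ^+ 2)%R]
                 <= (omega * enorm x ^+ 2)%:E)%E].

Definition mutually_independent {dT : measure_display} {T : measurableType dT}
    (P : probability T R) (I : choiceType) (F : I -> set_system T) : Prop :=
  forall (J : {fset I}) (E : I -> set T), (forall i, i \in J -> F i (E i)) ->
    (P (\big[setI/setT]_(i <- J) E i) = \prod_(i <- J) P (E i))%E.

Definition has_law {dT dS : measure_display} {T : measurableType dT}
    {S : measurableType dS} (P : probability T R) (X : {RV P >-> S})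
    (mu : probability S R) : Prop :=
  forall A, measurable A -> distribution P X A = mu A.

(* Number of Bernoulli(p) trials up to and including the first success. *)
Definition geometric_law {dT : measure_display} {T : measurableType dT}
    (P : probability T R) (N : {RV P >-> nat}) (p : R) : Prop :=
  forall n, distribution P N [set n.+1] = (p * (1 - p) ^+ n)%:E.

(* The sigma-algebras generated by all the random inputs: the compressor seeds
   xi_(k,j,m) and the epoch lengths N_k. *)
Definition input_sigma {dT dS : measure_display} {T : measurableType dT}
    {S : measurableType dS} (P : probability T R) {M : nat}
    (xi : nat -> nat -> 'I_M -> {RV P >-> S}) (N : nat -> {RV P >-> nat})
    (i : (nat * nat * 'I_M) + nat) : set_system T :=
  match i with
  | inl (k, j, m) => preimage_set_system setT (xi k j m) measurable
  | inr k => preimage_set_system setT (N k) measurable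
  end.

End Randomness.

(* Main.v *)
Require Import Defs.
From HB Require Import structures.
From mathcomp Require Import all_boot all_order all_algebra.
From mathcomp Require Import finmap.
From mathcomp Require Import all_classical all_reals all_analysis.
From mathcomp Require Import measurable_realfun.
From mathcomp Require Import ring lra.

Set Implicit Arguments.
Unset Strict Implicit.
Unset Printing Implicit Defensive.

Import Order.TTheory GRing.Theory Num.Theory.
Import numFieldNormedType.Exports.

Local Open Scope classical_set_scope.
Local Open Scope ring_scope.

(** The argument is deterministic until the last moment: a pathwise inequality
    for one inner iteration, all of whose terms are nonnegative, is integrated
    and summed over the geometric epoch length.

    Let [h = f_srv - f] and take [r x = |x|^2 / (2 theta) + h x] as reference
    function.  Relatedness makes [grad h] delta-Lipschitz
    ([grad_gap_lipschitz]), and [2 delta theta <= 1] then pinches the Bregman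
    distance [D] of [r] between [|x - y|^2 / (4 theta)] and three times that
    ([rbreg_lb], [rbreg_ub]), although neither [h] nor the local losses need
    be convex.  The optimality condition of the inner minimization reads
    [grad f u' + grad r u' = grad r u - e], where [e] is the average compression
    error ([epoch_step_eqn]): an inner iteration is a noisy proximal-point step
    on [f] in the geometry of [r].  The vector G of the z-step is
    [p (grad r x - grad r y')], so it belongs to the same geometry
    ([olga_succ]).

    With [u_0 = tau z + (1 - tau) y] and the potential
    [Phi u = tau D(xs, u) + (1 - tau) D(y, u)], the step inequality is applied
    to the comparators [xs] and [y] ([inner_step]) and added to the distance
    estimate of the z-step ([z_next_dist]).  The three-point identity rewrites
    the inner products with G as differences of [Phi], at the gain of
    [p D(u_0, u')]; cocoercivity of [grad r] ([rbreg_cocoercive]) and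
    [4 alpha p tau <= theta] pay for [|G|^2] with a part of this gain, and the
    remainder leaves the term [p / (16 theta) |u' - u_0|^2].  If [W u'] denotes
    the value of Y + Z for an epoch that ends at [u'], the value [W_0] being
    the right-hand side of the theorem, this gives, up to the factor
    [tau / alpha] in front of [W] and [W_0] ([epoch_inequality]),

      [W u' + (1 - p) Phi u' + p Phi u_0 + p/(16 theta) |u' - u_0|^2
         + |v|^2/(4 theta) <= W_0 + Phi u + theta |e + v/(2 theta)|^2],

    with [v = tau xs + (1 - tau) y - u].  The noise enters through one square,
    so no integrability has to be known beforehand.

    In expectation, the seed of one node is integrated out with everything else
    frozen ([freezing], an instance of Tonelli's theorem for a product law);
    unbiasedness kills the cross term ([compressor_second_moment]).  Doing this
    node after node ([sqr_noise_nodes]) bounds [E |e + v/(2 theta)|^2] by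
    [E |v|^2/(4 theta^2) + 4 delta^2 omega / M E |u - u_0|^2], and the first
    bound on [theta] makes the last coefficient at most [p / (16 theta^2)]
    ([noise_bound]).  Thus [|v|^2] cancels, and summing with the weights
    [p (1 - p)^n] of the epoch length, which is independent of the inner
    iterates, telescopes the potential, while the terms [|u - u_0|^2] start
    from zero and have decreasing weights ([geometric_telescope]).  Finiteness
    of the expectations propagates along the same recursion, and there is
    nothing to prove when [W_0] has infinite expectation
    ([epoch_expectation]). *)

(** * Euclidean inner product *)
Section Dot.
Context {R : realType} {d : nat}.
Implicit Types (u v w x y : 'rV[R]_d) (a : R).

Lemma dotvC u v : dotv u v = dotv v u.
Proof. by apply: eq_bigr => i _; rewrite mulrC. Qed.

Lemma dotvDl u v w : dotv (u + v) w = dotv u w + dotv v w.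
Proof. by rewrite -big_split; apply: eq_bigr => i _; rewrite mxE mulrDl. Qed.

Lemma dotvZl a u w : dotv (a *: u) w = a * dotv u w.
Proof. by rewrite /dotv big_distrr/=; apply: eq_bigr => i _; rewrite mxE mulrA. Qed.

Lemma dotvNl u w : dotv (- u) w = - dotv u w.
Proof. by rewrite -scaleN1r dotvZl mulN1r. Qed.

Lemma dot0v w : dotv 0 w = 0.
Proof. by rewrite -(scale0r 0) dotvZl mul0r. Qed.

Lemma dotvDr u v w : dotv w (u + v) = dotv w u + dotv w v.
Proof. by rewrite dotvC dotvDl !(dotvC w). Qed.

Lemma dotvZr a u w : dotv w (a *: u) = a * dotv w u.
Proof. by rewrite dotvC dotvZl (dotvC w). Qed.

Lemma dotvNr u w : dotv w (- u) = - dotv w u.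
Proof. by rewrite dotvC dotvNl (dotvC w). Qed.

Lemma dotv0 w : dotv w 0 = 0.
Proof. by rewrite dotvC dot0v. Qed.

Definition dotvE := (dotvDl, dotvDr, dotvNl, dotvNr, dotvZl, dotvZr, dot0v, dotv0).

Lemma dotvv_ge0 u : 0 <= dotv u u.
Proof. by apply: sumr_ge0 => i _; rewrite -expr2 sqr_ge0. Qed.

Lemma dotvv_eq0 u : dotv u u = 0 -> u = 0.
Proof.
move=> /eqP; rewrite psumr_eq0 => [/allP h|i _]; last by rewrite -expr2 sqr_ge0.
apply/rowP => i; rewrite mxE; apply/eqP.
by have := h i; rewrite mem_index_enum -expr2 sqrf_eq0; apply.
Qed.

Lemma enorm2 u : enorm u ^+ 2 = dotv u u.
Proof. by rewrite sqr_sqrtr// dotvv_ge0. Qed.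

Lemma enorm_ge0 u : 0 <= enorm u. Proof. exact: sqrtr_ge0. Qed.

Lemma coord_sqr_le u i : u 0 i ^+ 2 <= dotv u u.
Proof.
rewrite /dotv (bigD1 i)//= -expr2 lerDl.
by apply: sumr_ge0 => j _; rewrite -expr2 sqr_ge0.
Qed.

Lemma cauchy_schwarz u v : dotv u v ^+ 2 <= dotv u u * dotv v v.
Proof.
have [->|v0] := eqVneq v 0; first by rewrite !dotv0 mulr0 expr0n.
have vp : 0 < dotv v v.
  rewrite lt_def dotvv_ge0 andbT; apply: contra v0 => /eqP/dotvv_eq0 ->; exact: eqxx.
have := dotvv_ge0 (dotv v v *: u - dotv u v *: v).
have -> : dotv (dotv v v *: u - dotv u v *: v) (dotv v v *: u - dotv u v *: v) =
  dotv v v * (dotv u u * dotv v v - dotv u v ^+ 2).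
  by rewrite !dotvE (dotvC v u); ring.
by rewrite pmulr_rge0// subr_ge0.
Qed.

Lemma dotv_young (k : R) u v : 0 < k ->
  dotv u v <= k / 2 * dotv u u + (2 * k)^-1 * dotv v v.
Proof.
move=> k0; have k0' : k != 0 by rewrite gt_eqF.
have := dotvv_ge0 (k *: u - v); rewrite !dotvE (dotvC v u) => h.
have : 0 <= (2 * k)^-1 * (k * (k * dotv u u) - k * dotv u v -
   (k * dotv u v - dotv v v)) by rewrite mulr_ge0 ?invr_ge0; lra.
suff -> : (2 * k)^-1 * (k * (k * dotv u u) - k * dotv u v -
  (k * dotv u v - dotv v v)) = k / 2 * dotv u u + (2 * k)^-1 * dotv v v - dotv u v by lra.
by field.
Qed.

Lemma dotv_sqr_sub u v : dotv (u - v) (u - v) <= 2 * dotv u u + 2 * dotv v v.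
Proof. by have := dotvv_ge0 (u + v); rewrite !dotvE (dotvC v u); lra. Qed.

End Dot.

(** * Gradients, Lipschitz maps and Bregman distances *)
Section Calculus.
Context {R : realType} {d : nat}.
Implicit Types (g : 'rV[R]_d -> R) (a v x y : 'rV[R]_d).

Lemma derive_grad g x v : differentiable g x -> 'D_v g x = dotv (grad g x) v.
Proof.
move=> dg; rewrite deriveE// {1}[v]row_sum_delta linear_sum.
apply: eq_bigr => i _; rewrite linearZ/= mxE deriveE// mulrC.
by congr (_ * _).
Qed.

Lemma is_derive_line {W : normedModType R} (g : 'rV[R]_d -> W) a v (t : R) :
  differentiable g (a + t *: v) ->
  is_derive t (1 : R) (fun s : R => g (a + s *: v)) ('D_v g (a + t *: v)).
Proof.
move=> dg.
have E : (fun h : R => h^-1 *: (g (a + (h *: 1 + t) *: v) - g (a + t *: v))) =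
         (fun h : R => h^-1 *: (g (h *: v + (a + t *: v)) - g (a + t *: v))).
  apply/funext => h; congr (_ *: (g _ - _)).
  by rewrite scalerDl addrCA [h%:A]mulr1.
apply: DeriveDef; last by rewrite /derive/= E.
have /(_ v) := diff_derivable dg.
by rewrite /derivable /= E.
Qed.

(** Mean value theorem for the scalar function [t |-> <G x - G y, G (y + t (x - y))>]:
    pairing with the increment itself loses nothing, and Cauchy-Schwarz turns
    the value of the derivative into the bound. *)
Lemma lipschitz_of_jacobian (G : 'rV[R]_d -> 'rV[R]_d) (L : R) :
  (forall x, differentiable G x) ->
  (forall x v, dotv (v *m jacobian G x) (v *m jacobian G x) <= L ^+ 2 * dotv v v) ->
  forall x y, dotv (G x - G y) (G x - G y) <= L ^+ 2 * dotv (x - y) (x - y).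
Proof.
move=> dG JG x y; set v := x - y; set w := G x - G y.
pose psi (t : R) := \sum_(i < d) (w 0 i * G (y + t *: v) 0 i).
pose dpsi (t : R) := dotv w (v *m jacobian G (y + t *: v)).
have dp (t : R) : is_derive t 1 psi (dpsi t).
  have H i : is_derive t 1 (fun s => w 0 i * G (y + s *: v) 0 i)
      (w 0 i * (v *m jacobian G (y + t *: v)) 0 i).
    have dc : is_derive t 1 (fun s => G (y + s *: v) 0 i)
        ((v *m jacobian G (y + t *: v)) 0 i).
      have dl := @is_derive_line _ G y v t (dG _).
      rewrite -deriveEjacobian//.
      apply: DeriveDef.
        by have /derivable_mxP /(_ 0 i) := @ex_derive _ _ _ _ _ _ _ dl.
      by have := derive_mx (@ex_derive _ _ _ _ _ _ _ dl); rewrite derive_val => ->; rewrite mxE.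
    have := is_deriveZ (w 0 i) dc; by rewrite /GRing.scale/=.
  have := @is_derive_sum _ _ _ _ _ _ _ _ H.
  by rewrite /psi /dpsi /dotv; congr (is_derive _ _ _ _); apply/funext => s; rewrite fct_sumE.
have [|c _] := @MVT R psi dpsi 0 1 ltr01.
  by apply: continuous_subspaceT => t; apply: differentiable_continuous;
    apply/derivable1_diffP; exact: (@ex_derive _ _ _ _ _ _ _ (dp t)).
rewrite subr0 mulr1 => E.
have E2 : dotv w w = dotv w (v *m jacobian G (y + c *: v)).
  rewrite -/(dpsi c) -E /psi scale0r scale1r addr0 (_ : y + v = x) ?[y + v]addrC ?subrK// -sumrB.
  by apply: eq_bigr => i _; rewrite -mulrBr !mxE.
have := cauchy_schwarz w (v *m jacobian G (y + c *: v)); rewrite -E2 expr2.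
have [->|w0] := eqVneq (dotv w w) 0; first by rewrite mulr_ge0 ?sqr_ge0 ?dotvv_ge0.
rewrite ler_pM2l ?lt_def ?w0 ?dotvv_ge0// => /le_trans; apply; exact: JG.
Qed.

(** Signed, since [g] may fail to be convex; for the difference [hdiff] of two
    losses, two-sided bounds on it replace convexity. *)
Definition bregman g x y := g x - g y - dotv (grad g y) (x - y).

Lemma mulmx_jacobianB (G1 G2 : 'rV[R]_d -> 'rV[R]_d) x v :
  differentiable G1 x -> differentiable G2 x ->
  v *m jacobian (G1 - G2) x = v *m (jacobian G1 x - jacobian G2 x).
Proof.
move=> d1 d2.
have e1 := deriveEjacobian v d1; have e2 := deriveEjacobian v d2.
have e := deriveEjacobian v (differentiableB d1 d2).
have e' := deriveB (diff_derivable (v:=v) d1) (diff_derivable (v:=v) d2).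
rewrite mulmxBr; exact: (etrans (esym e) (etrans e' (congr2 (fun a b => a - b) e1 e2))).
Qed.

Lemma is_derive_quad (b c t : R) :
  is_derive t (1 : R) (fun s : R => b * s + c * s ^+ 2) (b + 2 * c * t).
Proof.
have := is_derive_poly (b *: 'X + c *: 'X^2) t.
have -> : (b *: 'X + c *: 'X^2)^`().[t] = b + 2 * c * t.
  by rewrite derivD !derivZ derivX derivXn !hornerE/=; ring.
suff -> : horner (b *: 'X + c *: 'X^2) = (fun s : R => b * s + c * s ^+ 2) by [].
by apply/funext => s; rewrite !hornerE.
Qed.

(** The descent lemma.  Along the segment, [g] minus its linearization minus
    [L/2 |.|^2] has a nonpositive derivative, by Young's inequality. *)
Lemma bregman_ub g (L : R) : 0 < L -> (forall x, differentiable g x) ->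
  (forall x y, dotv (grad g x - grad g y) (grad g x - grad g y) <=
     L ^+ 2 * dotv (x - y) (x - y)) ->
  forall x y, bregman g x y <= L / 2 * dotv (x - y) (x - y).
Proof.
move=> L0 dg Lg x y; have yv : y + (x - y) = x by rewrite addrC subrK.
rewrite /bregman; move: (x - y) yv => v yv.
pose phi (t : R) := g (y + t *: v) - (dotv (grad g y) v * t +
  (L / 2 * dotv v v) * t ^+ 2).
pose dphi (t : R) := dotv (grad g (y + t *: v)) v - (dotv (grad g y) v + L * t * dotv v v).
have dp (t : R) : is_derive t 1 phi (dphi t).
  apply: is_deriveB.
    by rewrite -derive_grad//; exact: is_derive_line.
  have -> : dotv (grad g y) v + L * t * dotv v v =
      dotv (grad g y) v + 2 * (L / 2 * dotv v v) * t by field.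
  exact: is_derive_quad.
have [|c + E] := @MVT R phi dphi 0 1 ltr01.
  by apply: continuous_subspaceT => t; apply: differentiable_continuous;
    apply/derivable1_diffP; exact: (@ex_derive _ _ _ _ _ _ _ (dp t)).
rewrite in_itv/= => /andP[c0 c1]; rewrite subr0 mulr1 in E.
have : dphi c <= 0.
  rewrite /dphi; have := Lg (y + c *: v) y; rewrite [y + _ - y]addrAC subrr add0r !dotvE => H.
  (* Young's inequality with this parameter makes both halves equal to
     (L c / 2) |v|^2. *)
  have Lc : 0 < (L * c)^-1 by rewrite invr_gt0 mulr_gt0.
  have := dotv_young (grad g (y + c *: v) - grad g y) v Lc.
  rewrite !dotvE => Y.
  have Lc0 : L * c != 0 by rewrite mulf_neq0 ?gt_eqF.
  have {}H := ler_wpM2l (ltW (divr_gt0 Lc (ltr0n _ 2))) H.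
  have Y1 : (L * c)^-1 / 2 * (L ^+ 2 * (c * (c * dotv v v))) = L * c / 2 * dotv v v.
    by field; rewrite !gt_eqF.
  have Y2 : (2 / (L * c))^-1 * dotv v v = L * c / 2 * dotv v v.
    by field; rewrite !gt_eqF.
  by lra.
rewrite -E /phi scale0r scale1r addr0 yv; lra.
Qed.

Lemma gradN g x : (forall x, differentiable g x) ->
  grad (- g) x = - grad g x.
Proof.
by move=> dg; apply/rowP => i; rewrite !mxE deriveN//; exact: diff_derivable.
Qed.

Lemma bregman_lb g (L : R) : 0 < L -> (forall x, differentiable g x) ->
  (forall x y, dotv (grad g x - grad g y) (grad g x - grad g y) <=
     L ^+ 2 * dotv (x - y) (x - y)) ->
  forall x y, - (L / 2 * dotv (x - y) (x - y)) <= bregman g x y.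
Proof.
move=> L0 dg Lg x y.
have := @bregman_ub (- g) L L0 _ _ x y; rewrite /bregman => h.
rewrite lerNl; apply: le_trans (h _ _).
- rewrite gradN// !dotvE [X in _ <= X - _ - _](_ : _ = - g x)//.
  rewrite [X in _ <= _ - X - _](_ : _ = - g y)//; lra.
- by move=> z; exact: differentiableN.
- by move=> a b; rewrite !gradN// -opprB opprK (addrC (- _)) -opprB !dotvE !(opprK, mulrN)//;
  have := Lg a b; rewrite !dotvE; lra.
Qed.

End Calculus.

(** * The spectral norm as an operator bound *)
Section SpectralNorm.
Context {R : realType} {d : nat}.

(** The set whose supremum defines [specnorm] is bounded, by the
    Hilbert-Schmidt norm, so the supremum is a true bound; homogeneity extends
    it from the unit ball to all vectors. *)
Lemma specnormP (A : 'M[R]_d) (L : R) : specnorm A <= L ->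
  forall v : 'rV[R]_d, dotv (v *m A) (v *m A) <= L ^+ 2 * dotv v v.
Proof.
move=> AL v.
have [->|v0] := eqVneq v 0; first by rewrite mul0mx !dot0v mulr0.
have nv : 0 < enorm v.
  rewrite lt_def enorm_ge0 andbT; apply: contra v0 => /eqP e.
  by apply/eqP/dotvv_eq0; rewrite -enorm2 e expr0n.
pose K := \sum_(j < d) \sum_(i < d) A i j ^+ 2.
have hs : has_ubound [set enorm (v *m A) | v in [set v : 'rV[R]_d | enorm v <= 1]].
  exists (Num.sqrt K) => _ [u /= u1 <-]; rewrite ler_wsqrtr//.
  apply: ler_sum => j _; rewrite -expr2.
  have -> : (u *m A) 0 j = dotv u (\row_i A i j).
    by rewrite mxE; apply: eq_bigr => i _; rewrite mxE.
  apply: le_trans (cauchy_schwarz _ _) _.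
  have -> : \sum_(i < d) A i j ^+ 2 = dotv (\row_i A i j) (\row_i A i j).
    by apply: eq_bigr => i _; rewrite !mxE expr2.
  by apply: ler_piMl; rewrite ?dotvv_ge0// -enorm2 expr_le1// enorm_ge0.
have uL : enorm ((enorm v)^-1 *: v *m A) <= L.
  apply: le_trans AL; apply: ub_le_sup hs _ _.
  exists ((enorm v)^-1 *: v) => //=.
  rewrite -(@expr_le1 _ 2) ?enorm_ge0// enorm2 !dotvE -enorm2.
  by rewrite mulrA -expr2 -exprMn mulVf ?expr1n// gt_eqF.
have : enorm ((enorm v)^-1 *: v *m A) ^+ 2 <= L ^+ 2.
  by rewrite ler_sqr// ?nnegrE ?enorm_ge0// (le_trans _ uL)// enorm_ge0.
rewrite enorm2 -scalemxAl !dotvE mulrA -expr2 exprVn -enorm2 => h.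
by rewrite -(enorm2 v) mulrC -ler_pdivrMl ?exprn_gt0// enorm2 -(enorm2 (v *m A)).
Qed.

End SpectralNorm.

(** * Euclidean norm and sup norm *)
Section Topology.
Context {R : realType} {d : nat}.
Implicit Types (u v w x y : 'rV[R]_d).

Lemma sqr_mx_norm_le x : `|x| ^+ 2 <= dotv x x.
Proof.
have [->|n0] := eqVneq `|x| 0; first by rewrite expr0n dotvv_ge0.
have [[i j] /= e] := mx_norm_neq0 n0.
have -> : `|x| = `|x 0 j| by rewrite -(ord1 i) -e.
by rewrite real_normK ?num_real// coord_sqr_le.
Qed.

Lemma dotvv_le_mx_norm x : dotv x x <= d%:R * `|x| ^+ 2.
Proof.
apply: (@le_trans _ _ (\sum_(i < d) `|x| ^+ 2)); last first.
  by rewrite sumr_const card_ord mulr_natl.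
apply: ler_sum => i _; rewrite -expr2 -(@real_normK _ (x 0 i)) ?num_real//.
rewrite ler_sqr ?nnegrE// [leRHS]mx_normrE.
by apply/bigmax_geP; right; exists (0, i).
Qed.

Lemma continuous_dotv {T : topologicalType} (f g : T -> 'rV[R]_d) (t : T) :
  {for t, continuous f} -> {for t, continuous g} ->
  {for t, continuous (fun s => dotv (f s) (g s))}.
Proof.
move=> cf cg; apply: cvg_big => [|i _]; first exact: add_continuous.
apply: cvgM.
  exact: (continuous_comp cf (@coord_continuous _ _ _ _ _ _)).
exact: (continuous_comp cg (@coord_continuous _ _ _ _ _ _)).
Qed.

Lemma continuous_of_lipschitz (f : 'rV[R]_d -> 'rV[R]_d) (L : R) :
  (forall x y, dotv (f x - f y) (f x - f y) <= L * dotv (x - y) (x - y)) ->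
  continuous f.
Proof.
move=> Lf x; apply/(@cvgrPdist_lt _ _ _ (nbhs x)) => e e0.
pose K : R := `|L| * d%:R + 1.
have K0 : 0 < K by rewrite ltr_wpDl// mulr_ge0.
near=> y.
have : `|f x - f y| ^+ 2 < e ^+ 2.
  apply: le_lt_trans (sqr_mx_norm_le _) _; apply: le_lt_trans (Lf _ _) _.
  apply: (@le_lt_trans _ _ (K * `|x - y| ^+ 2)).
    apply: (@le_trans _ _ (`|L| * dotv (x - y) (x - y))).
      by rewrite ler_wpM2r ?dotvv_ge0// ler_norm.
    apply: (@le_trans _ _ (`|L| * (d%:R * `|x - y| ^+ 2))).
      by rewrite ler_wpM2l// dotvv_le_mx_norm.
    by rewrite mulrA ler_wpM2r ?sqr_ge0// lerDl.
  rewrite mulrC -ltr_pdivlMr// -[ltRHS]sqr_sqrtr ?divr_ge0 ?sqr_ge0 ?ltW//.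
  rewrite ltr_sqr ?nnegrE ?sqrtr_ge0//; near: y.
  apply: (@cvgr_dist_lt _ _ _ (nbhs x)) => //; last by rewrite sqrtr_gt0 divr_gt0 ?exprn_gt0.
by rewrite ltr_sqr ?nnegrE// ltW.
Unshelve. all: by end_near. Qed.

End Topology.

(** * Proximal map of a weakly convex function *)
Section Prox.
Context {R : realType} {d : nat}.
Implicit Types (g : 'rV[R]_d -> R) (u v w x y s t : 'rV[R]_d).

Definition prox_obj (theta : R) g s u v : R :=
  dotv s (v - u) + (2 * theta)^-1 * enorm (v - u) ^+ 2 + g v.

(** The map inverse to [x |-> grad g x + theta^-1 *: x] ([proxP]): the objective
    with base point 0 and [s = - t] is [|v|^2/(2 theta) - <t, v> + g v]. *)
Definition prox (theta : R) g t := argmin (prox_obj theta g (- t) 0).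

Variables (theta : R) (g : 'rV[R]_d -> R).
Hypotheses (theta0 : 0 < theta) (dg : forall x, differentiable g x).
(* Weak convexity with half of the modulus of the quadratic term of prox_obj, so
   that prox_obj is strongly convex. *)
Hypothesis g_weak : forall x y,
  - ((4 * theta)^-1 * dotv (x - y) (x - y)) <= bregman g x y.

(** The quadratic term dominates the weak convexity defect, so the objective at
    a point far from [u] exceeds its value at [u], and a minimum over a large
    ball, which exists by compactness, is global. *)
Lemma prox_exists s u : exists x, is_argmin (prox_obj theta g s u) x.
Proof.
pose t := - (s + grad g u).
have i4 : (4 * theta)^-1 = theta^-1 / 4 by field; rewrite gt_eqF.
have i2 : (2 * theta)^-1 = theta^-1 / 2 by field; rewrite gt_eqF.
have th : 0 < theta^-1 by rewrite invr_gt0.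
have lb v : prox_obj theta g s u u + theta^-1 / 8 * dotv (v - u) (v - u)
    - 2 * theta * dotv t t <= prox_obj theta g s u v.
  have := g_weak v u; rewrite /prox_obj /bregman !enorm2 i4 i2.
  have k0 : 0 < 4 * theta by rewrite mulr_gt0.
  have := dotv_young t (v - u) k0; rewrite /t subrr.
  have -> : (2 * (4 * theta))^-1 = theta^-1 / 8 by field; rewrite gt_eqF.
  move: (v - u) => w; rewrite !dotvE (dotvC (grad g u) s); lra.
have cB : continuous (fun v : 'rV[R]_d => v - u).
  by move=> v; apply: (@cvgB _ _ _ (nbhs v) _ id (cst u) v u); [exact: cvg_id|exact: cvg_cst].
(* Outside this ball the quadratic gain in [lb] outweighs the constant
   2 theta |t|^2 that is lost there. *)
pose K := [set v : 'rV[R]_d | dotv (v - u) (v - u) <= 16 * theta ^+ 2 * dotv t t].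
have cF : continuous (prox_obj theta g s u).
  move=> v; apply: (@cvgD _ _ _ (nbhs v)); last exact: differentiable_continuous.
  have c1 := @continuous_dotv _ d 'rV[R]_d (cst s) _ v (@cst_continuous _ _ s v) (cB v).
  have c2 := @continuous_dotv _ d 'rV[R]_d _ _ v (cB v) (cB v).
  apply: (@cvgD _ _ _ (nbhs v)); first exact: c1.
  apply: (@cvgM _ _ (nbhs v)); first exact: cvg_cst.
  by under eq_fun do rewrite enorm2; rewrite enorm2; exact: c2.
have K0 : 0 <= 16 * theta ^+ 2 * dotv t t.
  by apply: mulr_ge0; rewrite ?dotvv_ge0// mulr_ge0 ?sqr_ge0.
have Ku : K u by rewrite /K/= subrr dotv0.
have cK : compact K.
  apply: bounded_closed_compact.
    pose B := Num.sqrt (16 * theta ^+ 2 * dotv t t).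
    exists (`|u| + B); split; first exact: num_real.
    move=> b ub v /= Kv; apply: ltW; apply: le_lt_trans ub.
    rewrite -(subrK u v) addrC (le_trans (ler_normD _ _))// lerD2l.
    rewrite -ler_sqr ?nnegrE ?sqrtr_ge0// sqr_sqrtr.
      exact: le_trans (sqr_mx_norm_le _) Kv.
    exact: K0.
  rewrite (_ : K = (fun v => dotv (v - u) (v - u)) @^-1` [set x | x <= 16 * theta ^+ 2 * dotv t t])//.
  apply: closed_comp; last exact: closed_le.
  by move=> v _; exact: (@continuous_dotv _ d 'rV[R]_d _ _ v (cB v) (cB v)).
have [||c cinK cmin] := @EVT_min_rV R _ (prox_obj theta g s u) K _ cK.
- by exists u.
- exact: continuous_subspaceT.
exists c => v; have [vK|vK] := boolP (v \in K); first exact: cmin.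
apply: le_trans (cmin u (mem_set Ku)) _; apply: le_trans (lb v); rewrite -addrA lerDl.
move: vK; rewrite notin_setE /K/= => /negP; rewrite -ltNge => /ltW.
move=> /(ler_wpM2l (ltW (divr_gt0 th (ltr0n _ 8)))).
have -> : theta^-1 / 8 * (16 * theta ^+ 2 * dotv t t) = 2 * theta * dotv t t.
  by field; rewrite gt_eqF.
by lra.
Qed.

Lemma prox_obj_line s u x r (t : R) :
  prox_obj theta g s u (x + t *: r) = prox_obj theta g s u x - g x
     + (dotv (s + theta^-1 *: (x - u)) r * t + (2 * theta)^-1 * dotv r r * t ^+ 2)
     + g (x + t *: r).
Proof.
rewrite /prox_obj addrAC [x + _ - u]addrAC !enorm2.
move: (x - u) => w; rewrite !dotvE (dotvC r w).
by field; rewrite gt_eqF.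
Qed.

(** The direction is the residual [r] of the stationarity equation itself: the
    derivative of the objective along [r] is [|r|^2], which vanishes at a
    minimizer. *)
Lemma prox_obj_optimality s u x : is_argmin (prox_obj theta g s u) x ->
  grad g x + theta^-1 *: x = theta^-1 *: u - s.
Proof.
move=> xmin; have th0 : theta != 0 by rewrite gt_eqF.
set r := s + theta^-1 *: (x - u) + grad g x.
suff : dotv r r = 0.
  move/dotvv_eq0 => r0.
  have <- : grad g x + theta^-1 *: x - r = theta^-1 *: u - s.
    by apply/rowP => i; rewrite !mxE; ring.
  by rewrite r0 subr0.
pose psi (t : R) := prox_obj theta g s u (x + t *: r).
have dpsi : is_derive (0 : R) 1 psi (dotv r r).
  have psiE := funext (prox_obj_line s u x r).
  rewrite /psi psiE.
  have dl : is_derive (0 : R) 1 (fun t : R => g (x + t *: r)) (dotv (grad g x) r).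
    have := @is_derive_line R d _ g x r 0 (dg _).
    by rewrite derive_grad// scale0r addr0.
  have dq := is_derive_quad (dotv (s + theta^-1 *: (x - u)) r) ((2 * theta)^-1 * dotv r r) 0.
  have db := is_deriveD (is_deriveD (is_derive_cst (prox_obj theta g s u x - g x) (0 : R) (1 : R)) dq) dl.
  by apply: (is_derive_eq db); rewrite mulr0 addr0 add0r -dotvDl.
have := @derive1_at_min R psi (-1) 1 0; case.
- lra.
- have dl (t : R) : derivable (fun s : R => g (x + s *: r)) t 1.
    exact: (@ex_derive _ _ _ _ _ _ _ (@is_derive_line R d _ g x r t (dg _))).
  move=> t _.
  have psiE := funext (prox_obj_line s u x r).
  rewrite /psi psiE; apply: derivableD => //; apply: derivableD => //.
- by rewrite in_itv/=; apply/andP; split; lra.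
- by move=> t _; rewrite /psi scale0r addr0; exact: xmin.
by move=> _; rewrite derive_val.
Qed.

(** The map [x |-> grad g x + x / theta] is strongly monotone with modulus
    [1/(2 theta)], so its inverse is Lipschitz with constant [2 theta].
    Uniqueness of the minimizer and measurability of the iterates both rest on
    this. *)
Lemma prox_equation_lipschitz x y :
  dotv (x - y) (x - y) <= 4 * theta ^+ 2 *
  dotv (grad g x + theta^-1 *: x - (grad g y + theta^-1 *: y))
       (grad g x + theta^-1 *: x - (grad g y + theta^-1 *: y)).
Proof.
have th0 : theta != 0 by rewrite gt_eqF.
have := g_weak x y; have := g_weak y x.
rewrite /bregman -[y - x]opprB !(dotvNl, dotvNr) opprK.
have -> : grad g x + theta^-1 *: x - (grad g y + theta^-1 *: y) =
   (grad g x - grad g y) + theta^-1 *: (x - y).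
  by apply/rowP => i; rewrite !mxE; ring.
move: (x - y) => w h1 h2.
set t := grad g x - grad g y + theta^-1 *: w.
have k0 : 0 < 2 * theta by rewrite mulr_gt0.
have := dotv_young t w k0.
have : theta^-1 / 2 * dotv w w <= dotv t w.
  rewrite /t !dotvE; have i4 : (4 * theta)^-1 = theta^-1 / 4 by field.
  by move: h1 h2; rewrite i4; lra.
have -> : (2 * (2 * theta))^-1 = theta^-1 / 4 by field.
move=> h3 h4.
have : theta^-1 / 4 * dotv w w <= theta * dotv t t by lra.
move=> /(ler_wpM2l (ltW (mulr_gt0 (ltr0n _ 4) theta0))).
have -> : 4 * theta * (theta^-1 / 4 * dotv w w) = dotv w w by field.
by rewrite mulrA => /le_trans; apply; rewrite le_eqVlt; apply/orP; left; apply/eqP; ring.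
Qed.

Lemma prox_equation_inj x y :
  grad g x + theta^-1 *: x = grad g y + theta^-1 *: y -> x = y.
Proof.
move=> e; have := prox_equation_lipschitz x y; rewrite e subrr dotv0 mulr0 => h.
by apply/eqP; rewrite -subr_eq0; apply/eqP/dotvv_eq0/eqP; rewrite eq_le h dotvv_ge0.
Qed.

Lemma proxP t : grad g (prox theta g t) + theta^-1 *: prox theta g t = t.
Proof.
have [x0 hx0] := prox_exists (- t) 0.
have : is_argmin (prox_obj theta g (- t) 0) (prox theta g t).
  exact: getPex (ex_intro _ _ hx0).
by move=> /prox_obj_optimality; rewrite scaler0 add0r opprK.
Qed.

(** The stationarity equation has a single solution, so the minimizer depends on
    [s] and [u] through [theta^-1 *: u - s] only. *)
Lemma argmin_prox_obj s u :
  argmin (prox_obj theta g s u) = prox theta g (theta^-1 *: u - s).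
Proof.
have [x0 hx0] := prox_exists s u.
have H : is_argmin (prox_obj theta g s u) (argmin (prox_obj theta g s u)).
  exact: getPex (ex_intro _ _ hx0).
by apply: prox_equation_inj; exact: etrans (prox_obj_optimality H) (esym (proxP _)).
Qed.

Lemma continuous_prox : continuous (prox theta g).
Proof.
apply: (@continuous_of_lipschitz _ _ _ (4 * theta ^+ 2)) => x y.
by have := prox_equation_lipschitz (prox theta g x) (prox theta g y); rewrite !proxP.
Qed.

End Prox.

(** * The z-step *)
Section ZStep.
Context {R : realType} {d : nat}.
Implicit Types (G w y z : 'rV[R]_d).

Definition z_obj (mu alpha : R) G y z w : R :=
  (2 * alpha)^-1 * enorm (w - z) ^+ 2 + dotv G w + mu / 2 * enorm (w - y) ^+ 2.

Definition z_next (mu alpha : R) G y z :=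
  (1 + mu * alpha)^-1 *: (z - alpha *: G + (mu * alpha) *: y).

(** Completing the square: [z_obj] is its value at [z_next] plus a positive
    multiple of the squared distance to [z_next]. *)
Lemma argmin_z_obj (mu alpha : R) G y z : 0 < mu -> 0 < alpha ->
  argmin (z_obj mu alpha G y z) = z_next mu alpha G y z.
Proof.
move=> mu0 al0.
have m0 : 1 + mu * alpha != 0 by rewrite gt_eqF// ltr_pwDl// mulr_ge0 ?ltW.
have a0 : alpha != 0 by rewrite gt_eqF.
set x := z_next mu alpha G y z.
have zE : z = (1 + mu * alpha) *: x + alpha *: G - (mu * alpha) *: y.
  by rewrite /x /z_next; apply/rowP => i; rewrite !mxE; field.
have key w : z_obj mu alpha G y z w = z_obj mu alpha G y z x +
    (1 + mu * alpha) / (2 * alpha) * dotv (w - x) (w - x).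
  rewrite /z_obj !enorm2 zE; move: x {zE} => x.
  have -> : w - ((1 + mu * alpha) *: x + alpha *: G - (mu * alpha) *: y) =
     (w - x) - alpha *: (mu *: (x - y) + G).
    by apply/rowP => i; rewrite !mxE; ring.
  have -> : x - ((1 + mu * alpha) *: x + alpha *: G - (mu * alpha) *: y) =
     - (alpha *: (mu *: (x - y) + G)).
    by apply/rowP => i; rewrite !mxE; ring.
  have -> : w - y = (w - x) + (x - y) by rewrite addrA subrK.
  have -> : dotv G w = dotv G (w - x) + dotv G x by rewrite -dotvDr subrK.
  move: (w - x) (x - y) => a b.
  rewrite !dotvE (dotvC b a) (dotvC a G) (dotvC G b); field; exact: a0.
have pos : 0 < (1 + mu * alpha) / (2 * alpha).
  by rewrite divr_gt0 ?mulr_gt0// ltr_pwDl// mulr_ge0 ?ltW.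
have xmin : is_argmin (z_obj mu alpha G y z) x.
  by move=> w; rewrite (key w) lerDl mulr_ge0 ?dotvv_ge0// ltW.
have amin : is_argmin (z_obj mu alpha G y z) (argmin (z_obj mu alpha G y z)).
  exact: getPex (ex_intro _ _ xmin).
apply/eqP; rewrite -subr_eq0; apply/eqP/dotvv_eq0/eqP; rewrite eq_le dotvv_ge0 andbT.
by have := amin x; rewrite (key (argmin _)) gerDl pmulr_rle0.
Qed.

(** Expanding the square around [z_next], the two sides differ by
    [mu alpha (1 + mu alpha) / 2] times the squared distance from [z_next] to
    [y]. *)
Lemma z_next_dist (mu alpha : R) G y z xs : 0 < mu -> 0 < alpha ->
  (1 + mu * alpha) / 2 * dotv (z_next mu alpha G y z - xs) (z_next mu alpha G y z - xs)
  <= 1 / 2 * dotv (z - xs) (z - xs) + alpha ^+ 2 / 2 * dotv G G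
     + mu * alpha / 2 * dotv (y - xs) (y - xs) - alpha * dotv G (z - xs).
Proof.
move=> mu0 al0.
have m0 : 1 + mu * alpha != 0 by rewrite gt_eqF// ltr_pwDl// mulr_ge0 ?ltW.
set x := z_next mu alpha G y z.
have zE : z = (1 + mu * alpha) *: x + alpha *: G - (mu * alpha) *: y.
  by rewrite /x /z_next; apply/rowP => i; rewrite !mxE; field.
move: x zE => x zE.
have -> : z - xs = (x - xs) + alpha *: G + (mu * alpha) *: ((x - xs) - (y - xs)).
  by rewrite zE; apply/rowP => i; rewrite !mxE; ring.
have p0 : 0 <= mu * alpha * (1 + mu * alpha).
  by rewrite !mulr_ge0 ?addr_ge0 ?mulr_ge0 ?ltW.
have := mulr_ge0 p0 (dotvv_ge0 ((x - xs) - (y - xs))).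
move: (x - xs) (y - xs) => b c.
rewrite !dotvE (dotvC b G) (dotvC c G) (dotvC c b); lra.
Qed.

End ZStep.

(** * Pathwise inequality for one inner iteration *)
Section Descent.
Context {R : realType} {d : nat}.
Variables (F h : 'rV[R]_d -> R) (theta mu : R).
Implicit Types (u v w x y z e : 'rV[R]_d).
Hypotheses (theta0 : 0 < theta) (mu0 : 0 < mu).
Hypothesis F_sc : strongly_convex mu F.
Hypothesis h_breg : forall x y,
  - ((4 * theta)^-1 * dotv (x - y) (x - y)) <= bregman h x y
    <= (4 * theta)^-1 * dotv (x - y) (x - y).

(** The Bregman distance of the reference function
    [r x = |x|^2 / (2 theta) + h x], whose gradient is [rgrad] below. *)
Definition rbreg (theta : R) (h : 'rV[R]_d -> R) x y :=
  (2 * theta)^-1 * dotv (x - y) (x - y) + bregman h x y.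

Definition rgrad (theta : R) (h : 'rV[R]_d -> R) x := theta^-1 *: x + grad h x.

Local Notation D := (rbreg theta h).
Local Notation gr := (rgrad theta h).

Let th0 : theta != 0. Proof. by rewrite gt_eqF. Qed.
Let i4 : (4 * theta)^-1 = theta^-1 / 4. Proof. by field. Qed.
Let i2 : (2 * theta)^-1 = theta^-1 / 2. Proof. by field. Qed.

Lemma rbreg_lb x y : (4 * theta)^-1 * dotv (x - y) (x - y) <= D x y.
Proof. by have /andP[] := h_breg x y; rewrite /rbreg i4 i2; lra. Qed.

Lemma rbreg_ub x y : D x y <= 3 * ((4 * theta)^-1 * dotv (x - y) (x - y)).
Proof. by have /andP[] := h_breg x y; rewrite /rbreg i4 i2; lra. Qed.

Lemma rbreg_ge0 x y : 0 <= D x y.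
Proof.
apply: le_trans (rbreg_lb x y); rewrite mulr_ge0 ?dotvv_ge0// invr_ge0 mulr_ge0//.
exact: ltW.
Qed.

Lemma three_point x u w : D x u - D x w - D w u = dotv (gr w - gr u) (x - w).
Proof.
rewrite /rbreg /rgrad /bregman i2; move: (grad h u) (grad h w) => a b.
rewrite !dotvE (dotvC u x) (dotvC w x) (dotvC w u); lra.
Qed.

(** A gradient step from [x] decreases [D(., y)], whose curvature is at most
    [3/(2 theta)], by at least the left-hand side, and [D(., y)] cannot become
    negative. *)
Lemma rbreg_cocoercive x y :
  theta / 3 * dotv (gr x - gr y) (gr x - gr y) <= D x y.
Proof.
(* 2 theta / 3 is the inverse curvature, the best step length. *)
have := three_point (x - (2 * theta / 3) *: (gr x - gr y)) y x.
move: (gr x - gr y) => g; set x' := x - _.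
have := rbreg_ge0 x' y; have := rbreg_ub x' x.
have -> : x' - x = - ((2 * theta / 3) *: g) by rewrite /x' addrAC subrr add0r.
rewrite !dotvE !opprK.
have -> : 3 * ((4 * theta)^-1 * (2 * theta / 3 * (2 * theta / 3 * dotv g g))) =
   theta / 3 * dotv g g by field.
lra.
Qed.

(** The mirror-descent estimate against an arbitrary comparator [x].  The error
    is tested against [x - u'], which depends on it; splitting
    [x - u' = (x - u) + (u - u')] leaves the term [<e, x - u>], in which [u] does
    not, and Young's inequality absorbs the other part into [D(u', u)]. *)
Lemma inner_step x u u' e :
  grad F u' + gr u' = gr u - e ->
  F u' - F x + mu / 2 * dotv (x - u') (x - u') <=
  D x u - D x u' + theta * dotv e e + dotv e (x - u).
Proof.
move=> eqn.
have := F_sc x u'; rewrite enorm2.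
have -> : grad F u' = - (gr u' - gr u) - e.
  by rewrite -[LHS](addrK (gr u')) eqn; apply/rowP => i; rewrite !mxE; ring.
have := three_point x u u'; have := rbreg_lb u' u.
have k0 : 0 < 2 * theta by rewrite mulr_gt0.
have := dotv_young e (u - u') k0.
have -> : 2 * theta / 2 = theta by field.
have -> : (2 * (2 * theta))^-1 = theta^-1 / 4 by field.
have -> : x - u = (x - u') - (u - u') by apply/rowP => i; rewrite !mxE; ring.
have -> : u' - u = - (u - u') by rewrite opprB.
move: (gr u' - gr u) (x - u') (u - u') => a b c.
rewrite i4 !dotvE; lra.
Qed.

Definition pot (tau : R) xs y u := tau * D xs u + (1 - tau) * D y u.

(** The inner step against [xs] and [y] with weights [tau] and [1 - tau], plus
    [tau / alpha] times the z-step.  The potential at [u'] loses the fraction [p]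
    because the z-step contributes [p] times the differences
    [D(x, u0) - D(x, u') + D(u0, u')].  The term [(4 theta)^-1 |v|^2] is added on
    both sides to complete the square of the noise. *)
Lemma epoch_inequality (tau p alpha : R) xs y z u u' e :
  0 < tau < 1 -> 0 < p < 1 -> 0 < alpha -> 4 * alpha * p * tau <= theta ->
  let u0 := tau *: z + (1 - tau) *: y in
  let v := tau *: xs + (1 - tau) *: y - u in
  let z' := z_next mu alpha (p *: (gr u0 - gr u')) u' z in
  grad F u' + gr u' = gr u - e ->
  tau / alpha * (alpha / tau * (F u' - F xs) +
    (1 + mu * alpha) / 2 * dotv (z' - xs) (z' - xs))
  + (1 - p) * pot tau xs y u' + p * pot tau xs y u0
  + p / (16 * theta) * dotv (u' - u0) (u' - u0) + (4 * theta)^-1 * dotv v v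
  <= tau / alpha * ((1 - tau) * (alpha / tau * (F y - F xs)) +
       (1 + mu * alpha)^-1 * ((1 + mu * alpha) / 2 * dotv (z - xs) (z - xs)))
     + pot tau xs y u + theta * dotv (e + (2 * theta)^-1 *: v) (e + (2 * theta)^-1 *: v).
Proof.
move=> /andP[tau0 tau1] /andP[p0 p1] al0 par u0 v z' eqn.
have m0 : 1 + mu * alpha != 0 by rewrite gt_eqF// ltr_pwDl// mulr_ge0 ?ltW.
have t0 : tau != 0 by rewrite gt_eqF.
have a0 : alpha != 0 by rewrite gt_eqF.
have -> : tau / alpha * ((1 - tau) * (alpha / tau * (F y - F xs)) +
       (1 + mu * alpha)^-1 * ((1 + mu * alpha) / 2 * dotv (z - xs) (z - xs))) =
   (1 - tau) * (F y - F xs) + tau / (2 * alpha) * dotv (z - xs) (z - xs).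
  by field; rewrite m0 t0 a0.
set zz := dotv (z' - xs) (z' - xs).
have -> : tau / alpha * (alpha / tau * (F u' - F xs) + (1 + mu * alpha) / 2 * zz) =
   F u' - F xs + tau / alpha * ((1 + mu * alpha) / 2 * zz).
  by field; rewrite t0 a0.
have -> : theta * dotv (e + (2 * theta)^-1 *: v) (e + (2 * theta)^-1 *: v) =
   theta * dotv e e + dotv e v + (4 * theta)^-1 * dotv v v.
  by move: v => b; rewrite !dotvE (dotvC b e); field.
set G := gr u0 - gr u' in z' zz *.
have ta : 0 < tau / alpha by rewrite divr_gt0.
have := ler_wpM2l (ltW ta) (@z_next_dist _ _ mu alpha (p *: G) u' z xs mu0 al0).
rewrite -/z' -/zz.
have -> : tau / alpha * (1 / 2 * dotv (z - xs) (z - xs) + alpha ^+ 2 / 2 * dotv (p *: G) (p *: G)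
    + mu * alpha / 2 * dotv (u' - xs) (u' - xs) - alpha * dotv (p *: G) (z - xs)) =
  tau / (2 * alpha) * dotv (z - xs) (z - xs) + (alpha * p * tau) * p / 2 * dotv G G
  + tau * mu / 2 * dotv (xs - u') (xs - u') - p * (tau * dotv G (z - xs)).
  rewrite -[u' - xs]opprB; move: (z - xs) (xs - u') (G) => a b c.
  by rewrite !dotvE; field; rewrite a0.
have -> : tau * dotv G (z - xs) = tau * dotv G (u0 - xs) + (1 - tau) * dotv G (u0 - y).
  by move: (G) => c; rewrite /u0 !dotvE; ring.
have T x : dotv G (u0 - x) = D x u0 - D x u' + D u0 u'.
  have := three_point x u' u0; rewrite -/G -[u0 - x]opprB dotvNr => <-; ring.
rewrite !T.
have := ler_wpM2l (ltW tau0) (inner_step xs eqn).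
have tau1' : 0 <= 1 - tau by lra.
have := ler_wpM2l tau1' (inner_step y eqn).
have -> : dotv e v = tau * dotv e (xs - u) + (1 - tau) * dotv e (y - u).
  by rewrite /v !dotvE; ring.
(* The gain p D(u0, u') covers |G|^2 with 3/8 of it and |u' - u0|^2 with 1/4. *)
have Gp : (alpha * p * tau) * p / 2 * dotv G G <= 3 * p / 8 * D u0 u'.
  have h1 := ler_wpM2l (ltW p0) (rbreg_cocoercive u0 u'); rewrite -/G in h1.
  have pG : 0 <= p * dotv G G by rewrite mulr_ge0 ?dotvv_ge0 ?ltW.
  have h2 := ler_wpM2r pG par.
  lra.
have Db : p / (16 * theta) * dotv (u' - u0) (u' - u0) <= p / 4 * D u0 u'.
  have -> : p / (16 * theta) * dotv (u' - u0) (u' - u0) =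
     p / 4 * ((4 * theta)^-1 * dotv (u0 - u') (u0 - u')).
    by rewrite -[u' - u0]opprB dotvNl dotvNr opprK; field.
  by rewrite ler_wpM2l ?rbreg_lb// divr_ge0// ltW.
have Dp : 0 <= p * D u0 u' by rewrite mulr_ge0 ?rbreg_ge0 ?ltW.
have yp : 0 <= (1 - tau) * (mu / 2 * dotv (y - u') (y - u')).
  by rewrite !mulr_ge0 ?dotvv_ge0 ?invr_ge0 ?ltW// subr_gt0.
rewrite /pot.
move: (dotv (z - xs) (z - xs)) zz (dotv (xs - u') (xs - u')) (dotv (y - u') (y - u')) (dotv e e)
  (dotv (u' - u0) (u' - u0)) Db yp (dotv G G) Gp => azz bzz n1 n2 ee n3 Db yp GG Gp.
lra.
Qed.

End Descent.

(** * Similarity of the losses and the equation of an inner iteration *)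
Section Setup.
Context {R : realType} {d M : nat}.
Variables (f : 'I_M -> 'rV[R]_d -> R) (srv : 'I_M) (delta mu theta : R).
Hypotheses (f_diff : forall m, twice_differentiable (f m)).
Hypotheses (delta0 : 0 < delta) (f_related : related f delta).
Hypotheses (mu0 : 0 < mu) (f_convex : strongly_convex mu (avg f)).
Hypotheses (theta0 : 0 < theta) (theta_delta : 2 * delta * theta <= 1).
Implicit Types (x y u v : 'rV[R]_d).

Definition hdiff w := f srv w - avg f w.

Lemma avg_fctE : avg f = M%:R^-1 *: \sum_(m < M) f m.
Proof. by apply/funext => x; rewrite /avg fctE fct_sumE. Qed.

Lemma differentiable_avg x : differentiable (avg f) x.
Proof.
rewrite avg_fctE; apply: differentiableZ.
by apply: differentiable_sum => m; have [] := f_diff m x.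
Qed.

Lemma grad_avg x : grad (avg f) x = M%:R^-1 *: \sum_(m < M) grad (f m) x.
Proof.
have df m : forall v, derivable (f m) x v.
  by move=> v; apply: diff_derivable; have [] := f_diff m x.
apply/rowP => i; rewrite !mxE summxE avg_fctE deriveZ; last exact: derivable_sum.
by rewrite derive_sum//; congr (_ * _); apply: eq_bigr => m _; rewrite mxE.
Qed.

Lemma differentiable_grad_avg x : differentiable (grad (avg f)) x.
Proof.
have -> : grad (avg f) = M%:R^-1 *: \sum_(m < M) grad (f m).
  by apply/funext => y; rewrite grad_avg fctE fct_sumE.
apply: differentiableZ; apply: differentiable_sum => m.
by have [] := f_diff m x.
Qed.

(** Everything that follows depends on the relatedness through this bound. *)
Lemma grad_gap_lipschitz m x y :
  dotv ((grad (f m) x - grad (avg f) x) - (grad (f m) y - grad (avg f) y))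
       ((grad (f m) x - grad (avg f) x) - (grad (f m) y - grad (avg f) y))
  <= delta ^+ 2 * dotv (x - y) (x - y).
Proof.
have dm z : differentiable (grad (f m)) z by have [] := f_diff m z.
have dG z : differentiable (grad (f m) - grad (avg f)) z.
  by apply: differentiableB => //; exact: differentiable_grad_avg.
apply: (lipschitz_of_jacobian dG) => z v.
rewrite (mulmx_jacobianB v (dm z) (differentiable_grad_avg z)).
exact: specnormP (f_related m z) v.
Qed.

Lemma differentiable_hdiff x : differentiable hdiff x.
Proof.
by apply: differentiableB; [have [] := f_diff srv x | exact: differentiable_avg].
Qed.

Lemma grad_hdiff x : grad hdiff x = grad (f srv) x - grad (avg f) x.
Proof.
apply/rowP => i; rewrite !mxE deriveB//; apply: diff_derivable.
  by have [] := f_diff srv x.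
exact: differentiable_avg.
Qed.

Lemma hdiff_bregman x y :
  - ((4 * theta)^-1 * dotv (x - y) (x - y)) <= bregman hdiff x y
    <= (4 * theta)^-1 * dotv (x - y) (x - y).
Proof.
have L a b : dotv (grad hdiff a - grad hdiff b) (grad hdiff a - grad hdiff b)
    <= delta ^+ 2 * dotv (a - b) (a - b).
  by rewrite !grad_hdiff; exact: grad_gap_lipschitz.
have ub := bregman_ub delta0 differentiable_hdiff L x y.
have lb := bregman_lb delta0 differentiable_hdiff L x y.
have : delta / 2 * dotv (x - y) (x - y) <= (4 * theta)^-1 * dotv (x - y) (x - y).
  rewrite ler_wpM2r ?dotvv_ge0// -ler_pdivlMr ?invr_gt0// invrK.
  have -> : (4 * theta)^-1 * 2 = (2 * theta)^-1 by field; rewrite gt_eqF.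
  have td : delta * (2 * theta) <= 1 by rewrite mulrCA mulrA.
  by rewrite -div1r ler_pdivlMr// mulr_gt0.
by move=> h; apply/andP; split; lra.
Qed.

(** The server loss is the convex function [avg f] plus [hdiff], so it inherits
    the weak convexity of [hdiff] and its proximal map is well defined. *)
Lemma srv_bregman x y :
  - ((4 * theta)^-1 * dotv (x - y) (x - y)) <= bregman (f srv) x y.
Proof.
have /andP[lb _] := hdiff_bregman x y.
have := f_convex x y; rewrite enorm2.
have : 0 <= mu / 2 * dotv (x - y) (x - y).
  by rewrite mulr_ge0 ?dotvv_ge0// divr_ge0// ltW.
move: lb; rewrite /bregman /hdiff grad_hdiff !dotvDl !dotvNl; lra.
Qed.

(** The vector that node [m] compresses. *)
Definition drift u0 u m := grad (f m) u - grad (f srv) u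
                - grad (f m) u0 + grad (f srv) u0.

Definition noise (q : 'I_M -> 'rV[R]_d -> 'rV[R]_d) u0 u :=
  M%:R^-1 *: \sum_(m < M) (q m (drift u0 u m) - drift u0 u m).

Definition step_dir (q : 'I_M -> 'rV[R]_d -> 'rV[R]_d) u0 u :=
  M%:R^-1 *: (\sum_(m < M) q m (drift u0 u m)) - grad (f srv) u0 + grad (avg f) u0.

Lemma epoch_stepE q u0 u : epoch_step f srv q theta u0 u =
  prox theta (f srv) (theta^-1 *: u - step_dir q u0 u).
Proof.
apply: argmin_prox_obj => //; last exact: srv_bregman.
by move=> x; have [] := f_diff srv x.
Qed.

(** A difference of the increments of [grad (f m) - grad (avg f)] and
    [grad (f srv) - grad (avg f)], each of them delta-Lipschitz. *)
Lemma drift_sqr u0 u m :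
  dotv (drift u0 u m) (drift u0 u m) <= 4 * delta ^+ 2 * dotv (u - u0) (u - u0).
Proof.
have -> : drift u0 u m = (grad (f m) u - grad (avg f) u - (grad (f m) u0 - grad (avg f) u0)) -
  (grad (f srv) u - grad (avg f) u - (grad (f srv) u0 - grad (avg f) u0)).
  rewrite /drift; move: (grad (f m) u) (grad (f m) u0) (grad (avg f) u) (grad (avg f) u0)
    (grad (f srv) u) (grad (f srv) u0) => a b c d' e g.
  by apply/rowP => i; rewrite !mxE; ring.
have := grad_gap_lipschitz m u u0; have := grad_gap_lipschitz srv u u0.
move: (grad (f m) u - _ - _) (grad (f srv) u - _ - _) => a b h1 h2.
by apply: le_trans (dotv_sqr_sub a b) _; lra.
Qed.

Lemma average_drift u0 u :
  M%:R^-1 *: (\sum_(m < M) drift u0 u m) = grad hdiff u0 - grad hdiff u.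
Proof.
have M0 : M%:R != 0 :> R by rewrite pnatr_eq0 -lt0n; exact: leq_ltn_trans (ltn_ord srv).
rewrite !grad_hdiff !grad_avg /drift.
have -> : \sum_(m < M) (grad (f m) u - grad (f srv) u - grad (f m) u0 + grad (f srv) u0) =
   \sum_(m < M) grad (f m) u - \sum_(m < M) grad (f m) u0
   + M%:R *: (grad (f srv) u0 - grad (f srv) u).
  have -> : M%:R *: (grad (f srv) u0 - grad (f srv) u) =
    \sum_(m < M) (grad (f srv) u0 - grad (f srv) u) by rewrite sumr_const card_ord scaler_nat.
  rewrite -sumrB -big_split/=.
  apply: eq_bigr => m _.
  move: (grad (f m) u) (grad (f m) u0) (grad (f srv) u) (grad (f srv) u0) => a b c e.
  by apply/rowP => i; rewrite !mxE; ring.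
move: (\sum_(m < M) grad (f m) u) (\sum_(m < M) grad (f m) u0)
  (grad (f srv) u) (grad (f srv) u0) => a b c e.
by apply/rowP => i; rewrite !mxE; field.
Qed.

(** Without compression error the direction [step_dir] is [- grad hdiff u], by
    [average_drift], and the iteration is the proximal-point step on [avg f] with
    respect to the reference function. *)
Lemma epoch_step_eqn q u0 u :
  grad (avg f) (epoch_step f srv q theta u0 u) +
    rgrad theta hdiff (epoch_step f srv q theta u0 u)
  = rgrad theta hdiff u - noise q u0 u.
Proof.
rewrite epoch_stepE.
have ds x : differentiable (f srv) x by have [] := f_diff srv x.
have := proxP theta0 ds srv_bregman (theta^-1 *: u - step_dir q u0 u).
move: (prox _ _ _) => x; rewrite /rgrad grad_hdiff => H.
have -> : grad (avg f) x + (theta^-1 *: x + (grad (f srv) x - grad (avg f) x))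
   = grad (f srv) x + theta^-1 *: x.
  move: (grad (f srv) x) (grad (avg f) x) => a b.
  by apply/rowP => i; rewrite !mxE; ring.
rewrite H /step_dir /noise sumrB scalerBr average_drift (grad_hdiff u0).
move: (_ *: \sum_(_ < _) _) (grad hdiff u) (grad (f srv) u0) (grad (avg f) u0) => a c e g.
by apply/rowP => i; rewrite !mxE; ring.
Qed.

End Setup.

(** * Measurability of random vectors *)
Section VectorMeasurability.
Context {R : realType} {dT : measure_display} {T : measurableType dT}.

(** Coordinatewise measurability: the form in which measurability of the
    compressor is given.  Its inputs must be Borel measurable, which
    [vmeasurable_borel] provides. *)
Definition vmeasurable {d} (u : T -> 'rV[R]_d) : Prop :=
  forall i, measurable_fun setT (fun w => u w 0 i).

Definition rational_box {d} (b : 'rV[rat]_d * nat) : set 'rV[R]_d :=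
  [set x | forall i, `|x 0 i - ratr (b.1 0 i)| < b.2.+1%:R^-1].

(** Countability of the set of rational boxes is what makes the Borel sets
    measurable for the coordinates. *)
Lemma open_rational_boxes {d} (U : set 'rV[R]_d) : open U ->
  U = \bigcup_(b in [set b | rational_box b `<=` U]) rational_box b.
Proof.
move=> oU; apply/seteqP; split => [x Ux|x [b sub xb]]; last exact: sub.
have /nbhs_ballP[e /= e0 eU] : nbhs x U by exact: open_nbhs_nbhs.
have e20 : 0 < e / 2 by rewrite divr_gt0.
(* A box of half-width below e/2 that contains x has diameter below e. *)
have [n ne] : exists n : nat, n.+1%:R^-1 < e / 2.
  have [n _ /(_ n (leqnn _)) ne] := near_infty_natSinv_lt (PosNum e20).
  by exists n.
have c_ex i : exists q : rat, `|x 0 i - ratr q| < n.+1%:R^-1.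
  have : x 0 i - n.+1%:R^-1 < x 0 i + n.+1%:R^-1 by rewrite ltrBlDr -addrA ltrDl addr_gt0.
  move=> /rat_in_itvoo[q /itvP qi]; exists q; rewrite distrC ltr_distl !qi//.
have [c cP] := choice c_ex.
exists (\row_i c i, n) => /=; last by move=> i; rewrite mxE.
move=> y yb; apply: eU; split=> // i j; rewrite (ord1 i) /ball/=.
have := yb j; rewrite mxE => h1; have h2 := cP j.
rewrite -[x 0 j](subrK (ratr (c j))) -addrA (le_lt_trans (ler_normD _ _))//.
rewrite [ltRHS](splitr e) ltrD ?(lt_trans h2)// distrC (lt_trans h1)//.
Qed.

Lemma vmeasurable_open {d} (u : T -> 'rV[R]_d) (U : set 'rV[R]_d) :
  vmeasurable u -> open U -> measurable (u @^-1` U).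
Proof.
move=> mu oU; rewrite (open_rational_boxes oU) preimage_bigcup bigcup_mkcond.
apply: countable_bigcupT_measurable => [|[c n]]; first exact: countableP.
case: ifP => // _.
rewrite [X in measurable X](_ : _ = \bigcap_(i in [set: 'I_d])
    ((fun w => `|u w 0 i - ratr (c 0 i)|) @^-1` `]-oo, n.+1%:R^-1[)); last first.
  apply/seteqP; split => w /= h i; first by move=> _; rewrite /= in_itv/=; exact: h.
  by have := h i Logic.I; rewrite /= in_itv.
apply: fin_bigcap_measurable => [|i _]; first exact: finite_finset.
rewrite -[X in measurable X]setTI; apply: measurableT_comp => //.
by apply: measurable_funB => //; exact: mu.
Qed.

Lemma vmeasurable_borel {d} (u : T -> 'rV[R]_d) : vmeasurable u ->
  measurable_fun setT (u : T -> g_sigma_algebraType (@open 'rV[R]_d)).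
Proof.
move=> mu; apply: (@measurability _ _ _ (g_sigma_algebraType (@open 'rV[R]_d)) _ _ (@open 'rV[R]_d)) => // _ [U oU <-].
by rewrite setTI; exact: vmeasurable_open.
Qed.

Lemma vmeasurable_scalar {d} (u : T -> 'rV[R]_d) (g : 'rV[R]_d -> R) :
  vmeasurable u -> continuous g -> measurable_fun setT (g \o u).
Proof.
move=> mu cg; apply: (measurability _ (RGenOpens.measurableE R)).
move=> /= _ [_ [a [b ->] <-]]; rewrite setTI comp_preimage.
apply: vmeasurable_open => //; apply: open_comp; last exact: interval_open.
by move=> x _; exact: cg.
Qed.

Lemma vmeasurable_comp {d n} (u : T -> 'rV[R]_d) (g : 'rV[R]_d -> 'rV[R]_n) :
  vmeasurable u -> continuous g -> vmeasurable (g \o u).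
Proof.
move=> mu cg i; apply: (vmeasurable_scalar (g := fun x => g x 0 i)) => // x.
exact: (continuous_comp (cg x) (@coord_continuous _ _ _ _ _ _)).
Qed.

Lemma vmeasurable_cst {d} (a : 'rV[R]_d) : vmeasurable (fun _ => a).
Proof. by move=> i; exact: measurable_cst. Qed.

Lemma vmeasurableD {d} (u v : T -> 'rV[R]_d) :
  vmeasurable u -> vmeasurable v -> vmeasurable (fun w => u w + v w).
Proof.
move=> mu mv i; under eq_fun do rewrite mxE.
by apply: measurable_funD; [exact: mu|exact: mv].
Qed.

Lemma vmeasurableZ {d} (a : R) (u : T -> 'rV[R]_d) :
  vmeasurable u -> vmeasurable (fun w => a *: u w).
Proof.
move=> mu i; under eq_fun do rewrite mxE.
by apply: measurable_funM => //; exact: mu.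
Qed.

Lemma vmeasurableB {d} (u v : T -> 'rV[R]_d) :
  vmeasurable u -> vmeasurable v -> vmeasurable (fun w => u w - v w).
Proof.
move=> mu mv i; under eq_fun do rewrite !mxE.
by apply: measurable_funB; [exact: mu|exact: mv].
Qed.

Lemma vmeasurable_sum {d} (I : eqType) (s : seq I) (u : I -> T -> 'rV[R]_d) :
  (forall i, i \in s -> vmeasurable (u i)) ->
  vmeasurable (fun w => \sum_(i <- s) u i w).
Proof.
elim: s => [|i s IH] mu.
  by under eq_fun do rewrite big_nil; exact: vmeasurable_cst.
under eq_fun do rewrite big_cons; apply: vmeasurableD.
  by apply: mu; rewrite mem_head.
by apply: IH => j js; apply: mu; rewrite inE js orbT.
Qed.

Lemma measurable_dotv {d} (u v : T -> 'rV[R]_d) :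
  vmeasurable u -> vmeasurable v -> measurable_fun setT (fun w => dotv (u w) (v w)).
Proof.
move=> mu mv; apply: measurable_sum => i.
by apply: measurable_funM; [exact: mu|exact: mv].
Qed.

(** Used for an epoch of random length. *)
Lemma vmeasurable_stop {d} (u : nat -> T -> 'rV[R]_d) (N : T -> nat) :
  (forall n, vmeasurable (u n)) -> measurable_fun setT N ->
  vmeasurable (fun w => u (N w) w).
Proof.
move=> mu mN i _ A mA; rewrite setTI.
rewrite [X in measurable X](_ : _ = \bigcup_n (N @^-1` [set n] `&`
    ((fun w => u n w 0 i) @^-1` A))); last first.
  apply/seteqP; split => w /=; first by move=> h; exists (N w).
  by move=> [n _ [<-]].
apply: bigcupT_measurable => n; apply: measurableI.
  by rewrite -[X in measurable X]setTI; exact: mN.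
by rewrite -[X in measurable X]setTI; exact: mu.
Qed.

End VectorMeasurability.

(** * Second moment of the compression error *)
Section Compressor.
Context {R : realType} {dS : measure_display} {S : measurableType dS} {d : nat}.
Variables (PS : probability S R) (Q : S -> 'rV[R]_d -> 'rV[R]_d) (omega : R).
Hypothesis Q_compr : unbiased_compressor PS Q omega.

Lemma compressor_vmeasurable {dT} {T : measurableType dT} (X : T -> S)
    (u : T -> 'rV[R]_d) : measurable_fun setT X -> vmeasurable u ->
  vmeasurable (fun w => Q (X w) (u w)).
Proof.
move=> mX mu i; have [mQ _ _] := Q_compr.
apply: (measurableT_comp (mQ i)
  (g := fun w => (X w, u w : g_sigma_algebraType (@open 'rV[R]_d)))).
by apply: measurable_fun_pair => //; exact: vmeasurable_borel.
Qed.

(** The cross term [2 c <v, Q x - x>] has expectation zero by unbiasedness.  It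
    has to be shown integrable first; the second moment provides this. *)
Lemma compressor_second_moment (v x : 'rV[R]_d) (c : R) :
  (\int[PS]_s (dotv (v + c *: (Q s x - x)) (v + c *: (Q s x - x)))%:E
    <= (dotv v v + c ^+ 2 * (omega * dotv x x))%:E)%E.
Proof.
have [_ Q1 Q2] := Q_compr.
have mQx : vmeasurable (fun s => Q s x).
  by apply: compressor_vmeasurable; [exact: measurable_id|exact: vmeasurable_cst].
have mE : vmeasurable (fun s => Q s x - x).
  by apply: vmeasurableB => //; exact: vmeasurable_cst.
have msq : measurable_fun setT (fun s => dotv (Q s x - x) (Q s x - x)).
  exact: measurable_dotv.
have Q2' : (\int[PS]_s (dotv (Q s x - x) (Q s x - x))%:E <= (omega * dotv x x)%:E)%E.
  have := Q2 x; rewrite unlock enorm2.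
  by under eq_integral do rewrite enorm2.
have isq : PS.-integrable setT (EFin \o (fun s => dotv (Q s x - x) (Q s x - x))).
  apply/integrableP; split; first exact/measurable_EFinP.
  under eq_integral do rewrite /= ger0_norm ?dotvv_ge0//.
  exact: le_lt_trans Q2' (ltry _).
have icst (a : R) : PS.-integrable setT (EFin \o cst a) by exact: finite_measure_integrable_cst.
(* Each coordinate of the error is dominated by 1 plus its squared norm. *)
have ie i : PS.-integrable setT (EFin \o (fun s => (Q s x - x) 0 i)).
  apply: (le_integrable measurableT _ _ (integrableD measurableT (icst 1) isq)).
    by apply/measurable_EFinP; exact: mE.
  move=> s _ /=; rewrite lee_fin.
  have := coord_sqr_le (Q s x - x) i; move: ((Q s x - x) 0 i) (dotv _ _) => a b ab.
  rewrite [leRHS]ger0_norm; last by rewrite addr_ge0// (le_trans (sqr_ge0 a)).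
  rewrite ler_norml; apply/andP; split.
    by have := sqr_ge0 (a + 1); have := sqr_ge0 a; lra.
  by have := sqr_ge0 (a - 1); have := sqr_ge0 a; lra.
have ie0 i : (\int[PS]_s ((Q s x - x) 0 i)%:E = 0)%E.
  have iQ : PS.-integrable setT (EFin \o (fun s => Q s x 0 i)).
    have := integrableD measurableT (ie i) (icst (x 0 i)).
    by apply: eq_integrable => // s _ /=; rewrite -EFinD !mxE subrK.
  under eq_integral do rewrite !mxE EFinD EFinN.
  rewrite integralB_EFin//; last exact: icst.
  have := Q1 x i; rewrite unlock => ->.
  by rewrite integral_cst//= probability_setT mule1 subee.
pose L (s : S) := \sum_(i < d) ((2 * c * v 0 i) * (Q s x - x) 0 i).
have iL1 i : PS.-integrable setT (fun s => (2 * c * v 0 i)%:E * ((Q s x - x) 0 i)%:E)%E.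
  by have := integrableZl measurableT (2 * c * v 0 i) (ie i).
have LE s : (L s)%:E = (\sum_(i < d) (2 * c * v 0 i)%:E * ((Q s x - x) 0 i)%:E)%E.
  by rewrite /L -sumEFin; apply: eq_bigr => i _; rewrite EFinM.
have iL : PS.-integrable setT (EFin \o L).
  have := @integrable_sum _ _ _ PS setT measurableT _ (index_enum 'I_d) xpredT
     (fun i s => (2 * c * v 0 i)%:E * ((Q s x - x) 0 i)%:E)%E (fun i _ => iL1 i).
  by apply: eq_integrable => // s _; rewrite /= LE.
have L0 : (\int[PS]_s (L s)%:E = 0)%E.
  under eq_integral do rewrite LE.
  rewrite integral_sum//.
  rewrite big1// => i _; rewrite integralZl//; last exact: ie.
  by rewrite ie0 mule0.
pose K (s : S) := dotv v v + c ^+ 2 * dotv (Q s x - x) (Q s x - x).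
have iK1 : PS.-integrable setT (EFin \o (fun s => c ^+ 2 * dotv (Q s x - x) (Q s x - x))).
  by have := integrableZl measurableT (c ^+ 2) isq.
have iK : PS.-integrable setT (EFin \o K).
  by have := integrableD measurableT (icst (dotv v v)) iK1.
have E s : dotv (v + c *: (Q s x - x)) (v + c *: (Q s x - x)) = K s + L s.
  have -> : L s = 2 * c * dotv v (Q s x - x).
    by rewrite /L /dotv mulr_sumr; apply: eq_bigr => i _; rewrite !mulrA.
  by rewrite /K; move: (Q s x - x) => e; rewrite !dotvE (dotvC e v); ring.
under eq_integral do rewrite E EFinD.
rewrite integralD_EFin// L0 adde0.
under eq_integral do rewrite /= /K EFinD.
rewrite integralD_EFin//; last exact: icst.
rewrite integral_cst//= probability_setT mule1 EFinD leeD2lE//.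
under eq_integral do rewrite /= (EFinM (c ^+ 2)).
rewrite integralZl// [leRHS](EFinM (c ^+ 2)).
by rewrite lee_wpmul2l// lee_fin sqr_ge0.
Qed.

End Compressor.

(** * Freezing an independent variable *)
Section Independence.
Context {R : realType} {dT : measure_display} {T : measurableType dT}.
Variable P : probability T R.

Section Freezing.
Context {dS : measure_display} {S : measurableType dS}.
Variables (X : {mfun T >-> S}) (G : set_system T).
Hypotheses (G_meas : G `<=` measurable) (GI : setI_closed G) (GT : G setT).
Hypothesis indep : forall A B, measurable A -> G B ->
  (P (X @^-1` A `&` B) = P (X @^-1` A) * P B)%E.

Local Notation TG := (g_sigma_algebraType G).

Let mid : measurable_fun setT (id : T -> TG).
Proof.
move=> _ A mA; rewrite setTI preimage_id.
have := smallest_sub (@sigma_algebra_measurable _ T) G_meas; exact.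
Qed.

(** Both sides are finite measures of [B] that agree on the pi-system [G]. *)
Lemma indep_sigma A B : measurable A -> <<s G >> B ->
  (P (X @^-1` A `&` B) = P (X @^-1` A) * P B)%E.
Proof.
move=> mA GB.
have mXA : measurable (X @^-1` A) by rewrite -[X in measurable X]setTI; exact: measurable_funP.
have r0 : 0 <= fine (P (X @^-1` A)) by rewrite fine_ge0.
have PX : (fine (P (X @^-1` A)))%:E = P (X @^-1` A).
  by rewrite fineK// fin_num_measure.
have key C : G C -> mrestr P mXA C = mscale (NngNum r0) P C.
  by move=> GC; rewrite /mrestr /mscale /= PX setIC indep.
have cover : \bigcup_(_ in [set: nat]) [set: T] = setT.
  by rewrite bigcup_const//; exists 0%N.
have fin (k : nat) : (mrestr P mXA setT < +oo)%E by rewrite /mrestr setTI -PX ltry.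
have := @g_sigma_algebra_measure_unique _ R T G G_meas (fun _ => setT) (fun _ => GT) cover
  (mrestr P mXA) (mscale (NngNum r0) P) GI key fin B GB.
by move=> H; rewrite -PX setIC; exact: H.
Qed.

(** By independence, the joint law of [X] and of the identity, seen as a random
    variable with values in the coarser measurable space, is a product; Tonelli's
    theorem does the rest.  Carrying the whole sample point as second argument
    spares an encoding of all the other random variables in one. *)
Lemma freezing (phi : S * TG -> \bar R) : measurable_fun setT phi ->
  (forall z, 0 <= phi z)%E ->
  (\int[P]_w phi (X w, w) = \int[P]_w \int[distribution P X]_s phi (s, w))%E.
Proof.
move=> mphi phi0.
pose idG : {mfun T >-> TG} := HB.pack (id : T -> TG)
  (isMeasurableFun.Build _ _ _ _ (id : T -> TG) mid).
have mpair : measurable_fun setT (fun w : T => (X w, w : TG)).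
  by apply: measurable_fun_pair; [exact: measurable_funP|exact: mid].
pose J : {mfun T >-> (S * TG)%type} := HB.pack (fun w : T => (X w, w : TG))
  (isMeasurableFun.Build _ _ _ _ (fun w : T => (X w, w : TG)) mpair).
have -> : (\int[P]_w phi (X w, w) = \int[distribution P J]_z phi z)%E.
  by rewrite ge0_integral_distribution.
rewrite (eq_measure_integral (distribution P X \x distribution P idG)%E); last first.
  move=> A mA _; apply/esym; apply: product_measure_unique => // B C mB mC.
  by rewrite /distribution /pushforward /=; exact: indep_sigma.
rewrite fubini_tonelli2// ge0_integral_distribution//.
  exact: measurable_fun_fubini_tonelli_G.
by move=> y; rewrite integral_ge0.
Qed.

End Freezing.

Section Others.
Variables (I : choiceType) (F : I -> set_system T).
Hypothesis F_meas : forall i, F i `<=` measurable.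
Hypothesis F_setI : forall i, setI_closed (F i).
Hypothesis F_setT : forall i, F i setT.
Hypothesis F_indep : mutually_independent P F.

(** A pi-system generating the sigma-algebra of all members of the family but
    the one of index [i].  Mutual independence speaks about it directly. *)
Definition others (i : I) : set_system T :=
  [set B | exists (J : {fset I}) (E : I -> set T),
     [/\ i \notin J, (forall j, j \in J -> F j (E j)) &
         B = \big[setI/setT]_(j <- J) E j]].

Lemma others_measurable i : others i `<=` measurable.
Proof.
move=> _ [J [E [_ FE ->]]]; rewrite -bigcap_fset.
apply: fin_bigcap_measurable => [|j /= jJ]; first exact: finite_fset.
by apply: F_meas; exact: FE.
Qed.

Lemma others_setT i : others i setT.
Proof. by exists fset0, (fun _ => setT); split => //; rewrite big_seq_fset0. Qed.

Lemma others_setI i : setI_closed (others i).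
Proof.
move=> _ _ [J [E [iJ FE ->]]] [J' [E' [iJ' FE' ->]]].
exists (J `|` J')%fset, (fun j => (if j \in J then E j else setT) `&`
  (if j \in J' then E' j else setT)); split.
- by rewrite in_fsetU negb_or iJ iJ'.
- move=> j _; apply: F_setI; case: ifPn => // h; [exact: FE|exact: FE'].
- rewrite -!bigcap_fset; apply/seteqP; split => w /=.
    move=> [h1 h2] j /=; rewrite in_fsetU => _; split; case: ifPn => // h;
      [exact: h1|exact: h2].
  move=> h; split => j /= jJ; have := h j; rewrite /= in_fsetU jJ ?orbT => /(_ erefl) [];
    by rewrite ?jJ.
Qed.

Lemma others_indep i A B : F i A -> others i B -> (P (A `&` B) = P A * P B)%E.
Proof.
move=> FA [J [E [iJ FE ->]]].
pose E' j := if j == i then A else E j.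
have EE : \big[setI/setT]_(j <- J) E' j = \big[setI/setT]_(j <- J) E j.
  apply: eq_big_seq => j jJ; rewrite /E'; case: eqP => // ji.
  by move: iJ; rewrite -ji jJ.
have := F_indep (J := (i |` J)%fset) (E := E').
rewrite !big_fsetU1//= EE [E' i]/E' eqxx => -> //.
  congr (_ * _)%E; rewrite (F_indep FE); apply: eq_big_seq => j jJ; rewrite /E'.
  by case: eqP => // ji; move: iJ; rewrite -ji jJ.
move=> j; rewrite in_fset1U /E'; case: eqP => [-> //|_ /= ]; exact: FE.
Qed.

Lemma others_gen i j : j != i -> F j `<=` <<s others i >>.
Proof.
move=> ji A FA; apply: sub_sigma_algebra.
exists [fset j]%fset, (fun _ => A); split.
- by rewrite in_fset1 eq_sym.
- by move=> l; rewrite in_fset1 => /eqP ->.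
- by rewrite big_seq_fset1.
Qed.

End Others.

End Independence.

(** * Measurability of the iterates *)
Section Trajectory.
Context {R : realType} {d M : nat}.
Variables (f : 'I_M -> 'rV[R]_d -> R) (srv : 'I_M) (delta mu theta : R).
Hypotheses (f_diff : forall m, twice_differentiable (f m)).
Hypotheses (delta0 : 0 < delta) (f_related : related f delta).
Hypotheses (mu0 : 0 < mu) (f_convex : strongly_convex mu (avg f)).
Hypotheses (theta0 : 0 < theta) (theta_delta : 2 * delta * theta <= 1).
Context {dS : measure_display} {S : measurableType dS} (PS : probability S R).
Variables (Q : S -> 'rV[R]_d -> 'rV[R]_d) (omega : R).
Hypothesis Q_compr : unbiased_compressor PS Q omega.

(** In terms of the reference function, the vector driving the z-step is
    [p (grad r x - grad r y')]. *)
Lemma olga_succ q N p tau alpha z0 k : 0 < alpha ->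
  let yz := olga f srv q N mu p theta tau alpha z0 k in
  let x := tau *: yz.2 + (1 - tau) *: yz.1 in
  let y' := epoch_iter f srv (q k) theta x (N k) in
  olga f srv q N mu p theta tau alpha z0 k.+1 =
  (y', z_next mu alpha (p *: (rgrad theta (hdiff f srv) x
                              - rgrad theta (hdiff f srv) y')) y' yz.2).
Proof.
move=> al0 /=; case: (olga _ _ _ _ _ _ _ _ _ _ _) => y z /=.
set x := tau *: z + _; set y' := epoch_iter _ _ _ _ _ _.
congr pair; rewrite -argmin_z_obj// /z_obj.
have E (a b : 'rV[R]_d) : rgrad theta (hdiff f srv) a - rgrad theta (hdiff f srv) b =
  grad (hdiff f srv) a - grad (hdiff f srv) b + theta^-1 *: (a - b).
  rewrite /rgrad; move: (grad _ a) (grad _ b) => c e.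
  by apply/rowP => i; rewrite !mxE; ring.
by rewrite E.
Qed.

Lemma continuous_avg : continuous (avg f).
Proof. by move=> x; exact: differentiable_continuous (differentiable_avg f_diff x). Qed.

Lemma continuous_hdiff : continuous (hdiff f srv).
Proof. by move=> x; exact: differentiable_continuous (differentiable_hdiff srv f_diff x). Qed.

Lemma continuous_grad_loss m : continuous (grad (f m)).
Proof.
by move=> x; apply: differentiable_continuous; have [] := f_diff m x.
Qed.

Lemma continuous_grad_avg : continuous (grad (avg f)).
Proof. by move=> x; exact: differentiable_continuous (differentiable_grad_avg f_diff x). Qed.

Context {dT : measure_display} {T : measurableType dT}.
Implicit Types (u v : T -> 'rV[R]_d).

Lemma vmeasurable_grad_hdiff u : vmeasurable u ->
  vmeasurable (fun w => grad (hdiff f srv) (u w)).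
Proof.
move=> mu'; under eq_fun do rewrite grad_hdiff//.
by apply: vmeasurableB; apply: (vmeasurable_comp mu');
  [exact: continuous_grad_loss|exact: continuous_grad_avg].
Qed.

Lemma vmeasurable_drift v u m : vmeasurable v -> vmeasurable u ->
  vmeasurable (fun w => drift f srv (v w) (u w) m).
Proof.
move=> m0 m1; apply: vmeasurableD; last first.
  exact: (vmeasurable_comp m0 (@continuous_grad_loss _)).
apply: vmeasurableB; last exact: (vmeasurable_comp m0 (@continuous_grad_loss _)).
by apply: vmeasurableB; exact: (vmeasurable_comp m1 (@continuous_grad_loss _)).
Qed.

Lemma vmeasurable_epoch_step (xi : 'I_M -> T -> S) v u :
  (forall m, measurable_fun setT (xi m)) -> vmeasurable v -> vmeasurable u ->
  vmeasurable (fun w => epoch_step f srv (fun m => Q (xi m w)) theta (v w) (u w)).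
Proof.
move=> mxi m0 m1.
under eq_fun do rewrite (epoch_stepE srv f_diff delta0 f_related mu0 f_convex theta0 theta_delta).
apply: (@vmeasurable_comp _ _ _ _ _
    (fun w => theta^-1 *: u w - step_dir f srv (fun m => Q (xi m w)) (v w) (u w))
    (prox theta (f srv))).
  apply: vmeasurableB; first exact: vmeasurableZ.
  apply: vmeasurableD; last exact: (vmeasurable_comp m0 continuous_grad_avg).
  apply: vmeasurableB; last exact: (vmeasurable_comp m0 (@continuous_grad_loss _)).
  apply: vmeasurableZ; apply: vmeasurable_sum => m _.
  by apply: (compressor_vmeasurable Q_compr) => //; exact: vmeasurable_drift.
apply: continuous_prox => //; last exact: (srv_bregman srv f_diff delta0 f_related mu0).
by move=> x; have [] := f_diff srv x.
Qed.

Lemma vmeasurable_epoch (xi : nat -> 'I_M -> T -> S) v j :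
  (forall i m, (i < j)%N -> measurable_fun setT (xi i m)) -> vmeasurable v ->
  vmeasurable (fun w => epoch_iter f srv (fun i m => Q (xi i m w)) theta (v w) j).
Proof.
move=> + m0; elim: j => [//|j IH] mxi /=.
apply: (@vmeasurable_epoch_step (xi j)) => //; first by move=> m; exact: mxi.
by apply: IH => i m ij; apply: mxi; exact: ltnW.
Qed.

Lemma vmeasurable_olga (xi : nat -> nat -> 'I_M -> T -> S) (N : nat -> T -> nat)
    p tau alpha z0 k : 0 < alpha ->
  (forall l j m, (l < k)%N -> measurable_fun setT (xi l j m)) ->
  (forall l, (l < k)%N -> measurable_fun setT (N l)) ->
  let yz w := olga f srv (fun k j m => Q (xi k j m w)) (fun k => N k w)
                 mu p theta tau alpha z0 k in
  vmeasurable (fun w => (yz w).1) /\ vmeasurable (fun w => (yz w).2).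
Proof.
move=> al0; elim: k => [|k IH] mxi mN.
  by split; exact: vmeasurable_cst.
have [|l lk|my mz] := IH; first by move=> l j m lk; apply: mxi; exact: ltnW.
  by apply: mN; exact: ltnW.
cbv zeta.
set yz := fun w => olga f srv (fun k j m => Q (xi k j m w)) (fun k => N k w)
                 mu p theta tau alpha z0 k in my mz.
have mx : vmeasurable (fun w => tau *: (yz w).2 + (1 - tau) *: (yz w).1).
  by apply: vmeasurableD; exact: vmeasurableZ.
have my' : vmeasurable (fun w => epoch_iter f srv (fun i m => Q (xi k i m w)) theta
    (tau *: (yz w).2 + (1 - tau) *: (yz w).1) (N k w)).
  apply: (vmeasurable_stop (u := fun n w => epoch_iter f srv (fun i m => Q (xi k i m w)) theta
    (tau *: (yz w).2 + (1 - tau) *: (yz w).1) n)); last exact: mN.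
  by move=> n; apply: vmeasurable_epoch => // i m _; exact: mxi.
have mgr (u : T -> 'rV[R]_d) : vmeasurable u -> vmeasurable (fun w => rgrad theta (hdiff f srv) (u w)).
  move=> m1; apply: vmeasurableD; first exact: vmeasurableZ.
  exact: vmeasurable_grad_hdiff.
split.
  by under eq_fun do rewrite olga_succ//=.
under eq_fun do rewrite olga_succ//=.
apply: vmeasurableZ; apply: vmeasurableD; last exact: vmeasurableZ.
apply: vmeasurableB => //; apply: vmeasurableZ; apply: vmeasurableZ.
by apply: vmeasurableB; exact: mgr.
Qed.

End Trajectory.

(** * Telescoping over a geometric number of steps *)
Section GeometricSum.
Context {R : realType}.

(** Weighted by [p (1 - p)^n], the terms [a] telescope to at most [p a 0], which
    the terms [p a 0] on the left compensate up to [p (1 - p)^K a 0]; the terms [b] have decreasing weights and start from zero.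
    The error disappears as K grows, and the partial sums increase. *)
Lemma geometric_telescope (p c beta : R) (a b W : nat -> R) : 0 < p < 1 ->
  0 <= beta -> 0 <= c ->
  (forall n, 0 <= a n) -> (forall n, 0 <= b n) -> (forall n, 0 <= W n) -> b 0%N = 0 ->
  (forall n, W n.+1 + (1 - p) * a n.+1 + p * a 0%N + beta * b n.+1 <=
             c + a n + beta * b n) ->
  forall K, \sum_(n < K) p * (1 - p) ^+ n * W n.+1 <= c.
Proof.
move=> /andP[p0 p1] beta0 c0 a0 b0 W0 b00 H.
have q0 : 0 <= 1 - p by lra.
have q1 : 1 - p < 1 by lra.
have inv K : \sum_(n < K) p * (1 - p) ^+ n * W n.+1 + p * (1 - p) ^+ K * a K
    + p * beta * (1 - p) ^+ K * b K <= (1 - (1 - p) ^+ K) * c + p * (1 - p) ^+ K * a 0%N.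
  elim: K => [|K IH]; first by rewrite big_ord0 expr0 b00; lra.
  rewrite big_ord_recr/= exprSr; move: IH (H K) (b0 K.+1).
  have := exprn_ge0 K q0; move: ((1 - p) ^+ K) (\sum_(n < K) _) => x s x0 IH HK bK.
  have px : 0 <= p * x := mulr_ge0 (ltW p0) x0.
  have h1 := ler_wpM2l px HK.
  have h2 : 0 <= p * x * (beta * p * b K.+1).
    by rewrite (mulr_ge0 px)// mulr_ge0// mulr_ge0// ltW.
  lra.
have mono K L : (K <= L)%N -> \sum_(n < K) p * (1 - p) ^+ n * W n.+1 <=
    \sum_(n < L) p * (1 - p) ^+ n * W n.+1.
  move=> KL; rewrite -!(big_mkord xpredT (fun n => p * (1 - p) ^+ n * W n.+1)).
  rewrite (big_cat_nat (leq0n K) KL)/= lerDl; apply: sumr_ge0 => i _.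
  by apply: mulr_ge0 => //; apply: mulr_ge0; [exact: ltW|exact: exprn_ge0].
move=> K; apply/ler_addgt0Pr => e e0.
have cq : (fun n => p * a 0%N * (1 - p) ^+ n) @ \oo --> (0 : R).
  rewrite -[X in _ --> X](mulr0 (p * a 0%N)); apply: cvgM; first exact: cvg_cst.
  by apply: cvg_expr; rewrite ger0_norm.
have /cvgrPdist_lt /(_ _ e0) [L _ HL] := cq.
have := HL (maxn K L) (leq_maxr _ _); rewrite sub0r normrN.
move=> /(le_lt_trans (ler_norm _)) hL.
apply: le_trans (mono _ _ (leq_maxl K L)) _.
have := inv (maxn K L); move: hL.
have := exprn_ge0 (maxn K L) q0; move: ((1 - p) ^+ maxn K L) (\sum_(n < _) _) => x s x0 hL hs.
have h1 : 0 <= p * x * a (maxn K L) by rewrite !mulr_ge0// ltW.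
have h2 : 0 <= p * beta * x * b (maxn K L) by rewrite !mulr_ge0// ltW.
have h3 : 0 <= x * c by rewrite mulr_ge0.
lra.
Qed.

Local Open Scope ereal_scope.

(** Finiteness of [a n], [b n] and [W n] passes from one index to the next
    through the inequality itself, so only the initial values have to be finite.
    The terms [v n], being below [a n], are then finite too and cancel. *)
Lemma geometric_telescope_ereal (p beta : R) (c : \bar R) (a b v W : nat -> \bar R) :
  (0 < p < 1)%R -> (0 < beta)%R -> 0 <= c -> c < +oo ->
  (forall n, 0 <= a n) -> (forall n, 0 <= b n) -> (forall n, 0 <= W n) ->
  (forall n, 0 <= v n) -> (forall n, v n <= a n) ->
  a 0%N < +oo -> b 0%N = 0 ->
  (forall n, W n.+1 + (1 - p)%:E * a n.+1 + p%:E * a 0%N + beta%:E * b n.+1 + v n <=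
             c + a n + beta%:E * b n + v n) ->
  forall K, \sum_(n < K) (p * (1 - p) ^+ n)%:E * W n.+1 <= c.
Proof.
move=> p01 be0 c0 coo a0 b0 W0 v0 va a0oo b00 H K.
have /andP[p0 p1] := p01.
have q0 : (0 < 1 - p)%R by rewrite subr_gt0.
have lty (r : R) x y : (0 < r)%R -> 0 <= x -> r%:E * x <= y -> y < +oo -> x < +oo.
  move=> r0 x0 rx yoo; rewrite ltey; apply/eqP => xoo; move: rx.
  by rewrite xoo gt0_muley ?lte_fin// leye_eq => /eqP yE; rewrite yE in yoo.
have fin n : [/\ a n < +oo, b n < +oo & W n.+1 < +oo].
  have step m : a m < +oo -> b m < +oo -> [/\ a m.+1 < +oo, b m.+1 < +oo & W m.+1 < +oo].
    move=> am bm.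
    have rhs : c + a m + beta%:E * b m + v m < +oo.
      rewrite !lte_add_pinfty//; last exact: le_lt_trans (va m) am.
      by rewrite lte_mul_pinfty// lee_fin ltW.
    have pa : 0 <= p%:E * a 0%N by rewrite mule_ge0// lee_fin ltW.
    have ba : 0 <= beta%:E * b m.+1 by rewrite mule_ge0// lee_fin ltW.
    have qa : 0 <= (1 - p)%:E * a m.+1 by rewrite mule_ge0// lee_fin ltW.
    split.
    - apply: (lty _ _ _ q0 _ _ rhs) => //; apply: le_trans (H m).
      apply: (le_trans (leeDr _ (W0 m.+1))); apply: (le_trans (leeDl _ pa)).
      exact: (le_trans (leeDl _ ba) (leeDl _ (v0 m))).
    - apply: (lty _ _ _ be0 _ _ rhs) => //; apply: le_trans (H m).
      apply: (le_trans _ (leeDl _ (v0 m))); apply: leeDr.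
      by apply: adde_ge0 => //; apply: adde_ge0 => //; exact: W0.
    - apply: le_lt_trans rhs; apply: le_trans (H m).
      apply: (le_trans (leeDl _ qa)); apply: (le_trans (leeDl _ pa)).
      exact: (le_trans (leeDl _ ba) (leeDl _ (v0 m))).
  have ab m : a m < +oo /\ b m < +oo.
    elim: m => [|m [am bm]]; first by rewrite b00 ltry.
    by have [] := step _ am bm.
  by have [am bm] := ab n; have [_ _ Wn] := step _ am bm.
have fa n : a n = (fine (a n))%:E.
  by rewrite fineK// ge0_fin_numE//; have [] := fin n.
have fb n : b n = (fine (b n))%:E.
  by rewrite fineK// ge0_fin_numE//; have [] := fin n.
have fW n : W n.+1 = (fine (W n.+1))%:E.
  by rewrite fineK// ge0_fin_numE//; have [] := fin n.
have fv n : v n = (fine (v n))%:E.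
  by rewrite fineK// ge0_fin_numE//; apply: le_lt_trans (va n) _; have [] := fin n.
have fc : c = (fine c)%:E by rewrite fineK// ge0_fin_numE.
have := @geometric_telescope p (fine c) beta (fun n => fine (a n)) (fun n => fine (b n))
  (fun n => if n is m.+1 then fine (W n) else 0%R) p01 (ltW be0) (fine_ge0 c0).
move=> /(_ _ _ _ _ _ K) G; rewrite fc.
under eq_bigr do rewrite fW -EFinM.
rewrite sumEFin lee_fin; apply: G.
- by move=> n; exact: fine_ge0.
- by move=> n; exact: fine_ge0.
- by case=> [//|n]; exact: fine_ge0.
- by rewrite b00.
move=> n; have := H n.
rewrite fW (fa n.+1) (fa 0%N) (fa n) (fb n.+1) (fb n) (fv n) fc.
by rewrite -!EFinM -!EFinD lee_fin lerD2r.
Qed.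

End GeometricSum.

(** * Independence of the random inputs *)
Section Inputs.
Context {R : realType} {M d : nat}.
Context {dS : measure_display} {S : measurableType dS} (PS : probability S R).
Context {dT : measure_display} {T : measurableType dT} (P : probability T R).
Variables (xi : nat -> nat -> 'I_M -> {RV P >-> S}) (N : nat -> {RV P >-> nat}).
Hypotheses (xi_law : forall k j m, has_law (xi k j m) PS).
Hypothesis indep : mutually_independent P (input_sigma xi N).

Definition input_index : choiceType := ((nat * nat * 'I_M) + nat)%type.

Local Notation F := (input_sigma xi N : input_index -> set_system T).

Lemma preimage_system_setI {d'} {S' : measurableType d'} (X : T -> S') :
  setI_closed (preimage_set_system setT X measurable).
Proof.
move=> _ _ [A mA <-] [B mB <-]; exists (A `&` B); first exact: measurableI.
by rewrite !setTI preimage_setI.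
Qed.

Lemma preimage_system_setT {d'} {S' : measurableType d'} (X : T -> S') :
  preimage_set_system setT X measurable setT.
Proof. by exists setT => //; rewrite setTI preimage_setT. Qed.

Lemma input_measurable i : F i `<=` measurable.
Proof.
by case: i => [[[k j] m]|k] _ [A mA <-]; exact: measurable_funP.
Qed.

Lemma input_setI i : setI_closed (F i).
Proof. by case: i => [[[k j] m]|k]; exact: preimage_system_setI. Qed.

Lemma input_setT i : F i setT.
Proof. by case: i => [[[k j] m]|k]; exact: preimage_system_setT. Qed.

(* The sample space equipped with the sigma-algebra of all inputs other than
   input i: measurability on it expresses that a variable does not depend on
   input i. *)
Local Notation omitting i := (g_sigma_algebraType (others F (i : input_index))).

Lemma omitting_sub i : <<s others F i >> `<=` measurable.
Proof.
apply: smallest_sub; first exact: sigma_algebra_measurable.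
exact: others_measurable input_measurable i.
Qed.

Lemma measurable_omitting {d'} {S' : measurableType d'} i (g : T -> S') :
  measurable_fun setT (g : omitting i -> S') -> measurable_fun setT g.
Proof.
move=> mg _ A mA; apply: (@omitting_sub i).
by have := mg measurableT A mA.
Qed.

Lemma vmeasurable_omitting i (g : T -> 'rV[R]_d) :
  vmeasurable (g : omitting i -> 'rV[R]_d) -> vmeasurable g.
Proof. by move=> mg j; exact: measurable_omitting (mg j). Qed.

Lemma seed_omitting i k j m : inl (k, j, m) != i ->
  measurable_fun setT (xi k j m : omitting i -> S).
Proof.
move=> ni _ A mA; apply: (others_gen (j := inl (k, j, m))) => //.
by exists A.
Qed.

Lemma length_omitting i k : inr k != i ->
  measurable_fun setT (N k : omitting i -> nat).
Proof.
move=> ni _ A mA; apply: (others_gen (j := inr k)) => //.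
by exists A.
Qed.

Local Open Scope ereal_scope.

(** Integrating out one compressor seed, the rest of the randomness being
    fixed. *)
Lemma seed_freezing k j m (phi : S * omitting (inl (k, j, m)) -> \bar R) :
  measurable_fun setT phi -> (forall z, 0 <= phi z) ->
  \int[P]_w phi (xi k j m w, w) = \int[P]_w \int[PS]_s phi (s, w).
Proof.
move=> mphi phi0.
rewrite (freezing (X := xi k j m) _ _ _ _ mphi phi0).
- apply: eq_integral => w _; apply: eq_measure_integral => A mA _.
  exact: xi_law.
- exact: others_measurable input_measurable _.
- exact: others_setI input_setI input_setT _.
- exact: others_setT input_setT _.
- move=> A B mA oB; apply: (others_indep indep (i := inl (k, j, m))) oB.
  by exists A => //; rewrite setTI.
Qed.

(** The event that the epoch has length [n] factors out of the expectation of a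
    variable that does not depend on that length. *)
Lemma length_freezing k n (g : omitting (inr k) -> \bar R) :
  measurable_fun setT g -> (forall w, 0 <= g w) ->
  \int[P]_(w in N k @^-1` [set n]) g w = distribution P (N k) [set n] * \int[P]_w g w.
Proof.
move=> mg g0.
pose phi (z : nat * omitting (inr k)) := (\1_[set n] z.1)%:E * g z.2.
have mN : measurable (N k @^-1` [set n]).
  by rewrite -[X in measurable X]setTI; exact: measurable_funP.
have mi : measurable_fun setT (\1_[set n] : nat -> R) by exact: measurable_indic.
have mphi : measurable_fun setT phi.
  apply: emeasurable_funM.
    apply/measurable_EFinP; exact: (measurableT_comp mi measurable_fst).
  exact: (measurableT_comp mg measurable_snd).
have -> : \int[P]_(w in N k @^-1` [set n]) g w = \int[P]_w phi (N k w, w).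
  rewrite integral_mkcond; apply: eq_integral => w _; rewrite /phi /patch /= indicE.
  have -> : (w \in N k @^-1` [set n]) = (N k w \in [set n]) by [].
  by case: ifP; rewrite ?mul1e ?mul0e.
rewrite (freezing (X := N k) _ _ _ _ mphi).
- transitivity (\int[P]_w (distribution P (N k) [set n] * g w)).
    apply: eq_integral => w _.
    by rewrite /phi /= ge0_integralZr// integral_indic// setIT.
  rewrite ge0_integralZl//; exact: measurable_omitting mg.
- exact: others_measurable input_measurable _.
- exact: others_setI input_setI input_setT _.
- exact: others_setT input_setT _.
- move=> A B mA oB; apply: (others_indep indep (i := inr k)) oB.
  by exists A => //; rewrite setTI.
- by move=> z; rewrite mule_ge0.
Qed.

End Inputs.

(** * Expectation of nonnegative functions *)
Section NonnegExpectation.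
Context {R : realType} {dT : measure_display} {T : measurableType dT}.
Variable P : probability T R.
Implicit Types f g : T -> R.
Local Open Scope ereal_scope.

Lemma ge0_expectationD f g : measurable_fun setT f -> measurable_fun setT g ->
  (forall w, 0 <= f w)%R -> (forall w, 0 <= g w)%R ->
  'E_P[fun w => (f w + g w)%R] = 'E_P[f] + 'E_P[g].
Proof.
move=> mf mg f0 g0; rewrite unlock.
under eq_integral do rewrite EFinD.
rewrite ge0_integralD//.
- by move=> w _; rewrite lee_fin.
- exact/measurable_EFinP.
- by move=> w _; rewrite lee_fin.
- exact/measurable_EFinP.
Qed.

Lemma ge0_expectationZl (r : R) f : (0 <= r)%R -> measurable_fun setT f ->
  (forall w, 0 <= f w)%R -> 'E_P[fun w => (r * f w)%R] = r%:E * 'E_P[f].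
Proof.
move=> r0 mf f0; rewrite unlock.
under eq_integral do rewrite EFinM.
rewrite ge0_integralZl_EFin//; last exact/measurable_EFinP.
by move=> w _; rewrite lee_fin.
Qed.

Lemma ge0_expectation_le f g : measurable_fun setT f -> measurable_fun setT g ->
  (forall w, 0 <= f w)%R -> (forall w, f w <= g w)%R -> 'E_P[f] <= 'E_P[g].
Proof.
move=> mf mg f0 fg; rewrite unlock; apply: ge0_le_integral => //.
- by move=> w _; rewrite lee_fin.
- exact/measurable_EFinP.
- exact/measurable_EFinP.
- by move=> w _; rewrite lee_fin.
Qed.

End NonnegExpectation.

(** * Second moment of the average compression error *)
Section Peeling.
Context {R : realType} {M d : nat}.
Context {dS : measure_display} {S : measurableType dS} (PS : probability S R).
Context {dT : measure_display} {T : measurableType dT} (P : probability T R).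
Variables (xi : nat -> nat -> 'I_M -> {RV P >-> S}) (N : nat -> {RV P >-> nat}).
Hypotheses (xi_law : forall k j m, has_law (xi k j m) PS).
Hypothesis indep : mutually_independent P (input_sigma xi N).
Variables (Q : S -> 'rV[R]_d -> 'rV[R]_d) (omega : R).
Hypotheses (Q_compr : unbiased_compressor PS Q omega) (omega0 : 0 <= omega).

Local Notation F := (input_sigma xi N : input_index -> set_system T).
Local Notation omitting i := (g_sigma_algebraType (others F (i : input_index))).
Local Notation sqn v := (dotv v v).

Local Open Scope ereal_scope.

Lemma sqr_noise_one_node k j m (v g : T -> 'rV[R]_d) (c : R) :
  vmeasurable (v : omitting (inl (k, j, m)) -> 'rV[R]_d) ->
  vmeasurable (g : omitting (inl (k, j, m)) -> 'rV[R]_d) ->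
  'E_P[fun w => sqn (v w + c *: (Q (xi k j m w) (g w) - g w))] <=
  'E_P[fun w => (sqn (v w) + c ^+ 2 * (omega * sqn (g w)))%R].
Proof.
move=> mv mg; rewrite unlock.
pose O := omitting (inl (k, j, m)).
pose phi (z : S * O) := (sqn (v z.2 + c *: (Q z.1 (g z.2) - g z.2)))%:E.
have msnd (h : O -> 'rV[R]_d) : vmeasurable h -> vmeasurable (fun z : S * O => h z.2).
  by move=> mh i; exact: (measurableT_comp (mh i) measurable_snd).
have mphi : measurable_fun setT phi.
  apply/measurable_EFinP.
  have me : vmeasurable (fun z : S * O => (v z.2 + c *: (Q z.1 (g z.2) - g z.2))%R).
    apply: vmeasurableD; first exact: msnd.
    apply: vmeasurableZ; apply: vmeasurableB; last exact: msnd.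
    by apply: (compressor_vmeasurable Q_compr); [exact: measurable_fst|exact: msnd].
  exact: measurable_dotv.
have phi0 z : 0 <= phi z by rewrite lee_fin dotvv_ge0.
have -> : \int[P]_w (sqn (v w + c *: (Q (xi k j m w) (g w) - g w)))%:E =
    \int[P]_w phi (xi k j m w, w) by [].
rewrite (seed_freezing xi_law indep mphi phi0).
apply: ge0_le_integral => //.
- by move=> w _; rewrite integral_ge0.
- apply: (@measurable_omitting _ _ _ _ _ _ P xi N _ _ (inl (k, j, m))).
  exact: (measurable_fun_fubini_tonelli_G phi).
- apply/measurable_EFinP; apply: measurable_funD.
    by apply: measurable_dotv; exact: vmeasurable_omitting mv.
  apply: measurable_funM; first exact: measurable_cst.
  apply: measurable_funM; first exact: measurable_cst.
  by apply: measurable_dotv; exact: vmeasurable_omitting mg.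
- by move=> w _; exact: (compressor_second_moment Q_compr (v w) (g w) c).
Qed.

(** Induction on the nodes.  The noise of the nodes already treated is part of
    the vector frozen while the seed of the next node is integrated out, so the
    cross terms between different nodes vanish as well. *)
Lemma sqr_noise_nodes k j (v : T -> 'rV[R]_d) (g : 'I_M -> T -> 'rV[R]_d) (c : R) (s : seq 'I_M) :
  uniq s ->
  (forall m, vmeasurable (v : omitting (inl (k, j, m)) -> 'rV[R]_d)) ->
  (forall m m', vmeasurable (g m' : omitting (inl (k, j, m)) -> 'rV[R]_d)) ->
  'E_P[fun w => sqn (v w + c *: \sum_(m <- s) (Q (xi k j m w) (g m w) - g m w))] <=
  'E_P[fun w => (sqn (v w) + \sum_(m <- s) c ^+ 2 * (omega * sqn (g m w)))%R].
Proof.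
move=> + mv mg; elim: s => [_|m s IH /= /andP[ms us]].
  rewrite le_eqVlt; apply/orP; left; apply/eqP; congr expectation.
  by apply/funext => w; rewrite !big_nil scaler0 !addr0.
pose v' w := (v w + c *: \sum_(m <- s) (Q (xi k j m w) (g m w) - g m w))%R.
have mv' : vmeasurable (v' : omitting (inl (k, j, m)) -> 'rV[R]_d).
  apply: vmeasurableD; first exact: mv.
  apply: vmeasurableZ; apply: vmeasurable_sum => l ls.
  apply: vmeasurableB; last exact: mg.
  apply: (compressor_vmeasurable Q_compr); last exact: mg.
  apply: seed_omitting; apply: contra ms => /eqP[lm].
  by rewrite -lm.
have msq (h : T -> 'rV[R]_d) : vmeasurable (h : omitting (inl (k, j, m)) -> 'rV[R]_d) ->
    measurable_fun setT (fun w => sqn (h w)).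
  by move=> mh; apply: measurable_dotv; exact: vmeasurable_omitting mh.
have mterm l : measurable_fun setT (fun w => (c ^+ 2 * (omega * sqn (g l w)))%R).
  apply: measurable_funM; first exact: measurable_cst.
  by apply: measurable_funM; [exact: measurable_cst|exact: msq].
have pterm l w : (0 <= c ^+ 2 * (omega * sqn (g l w)))%R.
  by rewrite mulr_ge0 ?sqr_ge0// mulr_ge0 ?dotvv_ge0.
have -> : (fun w => sqn (v w + c *: \sum_(l <- m :: s) (Q (xi k j l w) (g l w) - g l w))) =
  (fun w => sqn (v' w + c *: (Q (xi k j m w) (g m w) - g m w))).
  apply/funext => w; rewrite big_cons /v' scalerDr.
  by congr dotv; rewrite -addrA; congr (_ + _)%R; rewrite addrC.
apply: le_trans (sqr_noise_one_node _ mv' (mg m m)) _.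
rewrite ge0_expectationD//; last 2 first.
- exact: msq.
- by move=> w; exact: dotvv_ge0.
have -> : (fun w => (sqn (v w) + \sum_(l <- m :: s) c ^+ 2 * (omega * sqn (g l w)))%R) =
   (fun w => ((sqn (v w) + \sum_(l <- s) c ^+ 2 * (omega * sqn (g l w))) +
      c ^+ 2 * (omega * sqn (g m w)))%R).
  by apply/funext => w; rewrite big_cons -addrA; congr (_ + _)%R; rewrite addrC.
rewrite ge0_expectationD//; last 2 first.
- apply: measurable_funD; first exact: msq.
  by apply: measurable_sum => l; exact: mterm.
- by move=> w; rewrite addr_ge0 ?dotvv_ge0// sumr_ge0.
by apply: leeD2r; exact: IH.
Qed.

End Peeling.

(** * Expected decrease over one epoch *)
Section Epoch.
Context {R : realType} {d M : nat}.
Variables (f : 'I_M -> 'rV[R]_d -> R) (srv : 'I_M).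
Variables (delta mu theta p tau alpha omega : R) (xs : 'rV[R]_d).
Hypotheses (f_diff : forall m, twice_differentiable (f m)).
Hypotheses (delta0 : 0 < delta) (f_related : related f delta).
Hypotheses (mu0 : 0 < mu) (f_convex : strongly_convex mu (avg f)).
Hypotheses (xs_min : is_argmin (avg f) xs).
Hypotheses (theta0 : 0 < theta) (theta_delta : 2 * delta * theta <= 1).
Hypotheses (p01 : 0 < p < 1) (tau01 : 0 < tau < 1) (alpha0 : 0 < alpha).
Hypotheses (alpha_le : 4 * alpha * p * tau <= theta) (omega0 : 0 <= omega).
Hypothesis noise_le : 4 * delta ^+ 2 * omega / M%:R <= p / (16 * theta ^+ 2).
Context {dS : measure_display} {S : measurableType dS} (PS : probability S R).
Context {dT : measure_display} {T : measurableType dT} (P : probability T R).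
Variables (xi : nat -> nat -> 'I_M -> {RV P >-> S}) (N : nat -> {RV P >-> nat}).
Hypotheses (xi_law : forall k j m, has_law (xi k j m) PS).
Hypotheses (N_law : forall k, geometric_law (N k) p).
Hypothesis indep : mutually_independent P (input_sigma xi N).
Variables (Q : S -> 'rV[R]_d -> 'rV[R]_d).
Hypotheses (Q_compr : unbiased_compressor PS Q omega).

Local Notation F := (input_sigma xi N : input_index -> set_system T).
Local Notation omitting i := (g_sigma_algebraType (others F (i : input_index))).
Local Notation sqn v := (dotv v v).

Variables (k : nat) (y z : T -> 'rV[R]_d).
Hypotheses (y_seed : forall j m, vmeasurable (y : omitting (inl (k, j, m)) -> 'rV[R]_d)).
Hypotheses (z_seed : forall j m, vmeasurable (z : omitting (inl (k, j, m)) -> 'rV[R]_d)).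
Hypotheses (y_length : vmeasurable (y : omitting (inr k) -> 'rV[R]_d)).
Hypotheses (z_length : vmeasurable (z : omitting (inr k) -> 'rV[R]_d)).

Local Notation favg := (avg f).
Local Notation h := (hdiff f srv).

(* The quantities below are those of an epoch that starts from the history
   (y, z): the iterate U n after n inner steps, and the value lyap n of the
   Lyapunov function if the epoch stopped there.  The terms A, B and V are the
   potential, the squared distance to the starting point and the square
   completing the noise, all in the scale of lyap. *)
Let u0 w := tau *: z w + (1 - tau) *: y w.
Let U n w := epoch_iter f srv (fun i m => Q (xi k i m w)) theta (u0 w) n.
Let z' n w := z_next mu alpha (p *: (rgrad theta h (u0 w) - rgrad theta h (U n w)))
                (U n w) (z w).
Let lyap n w := alpha / tau * (favg (U n w) - favg xs)
                + (1 + mu * alpha) / 2 * sqn (z' n w - xs).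
Let lyap0 w := (1 - tau) * (alpha / tau * (favg (y w) - favg xs))
                + (1 + mu * alpha)^-1 * ((1 + mu * alpha) / 2 * sqn (z w - xs)).
Let A n w := alpha / tau * pot h theta tau xs (y w) (U n w).
Let B n w := sqn (U n w - u0 w).
Let v n w := tau *: xs + (1 - tau) *: y w - U n w.
Let V n w := alpha / tau * ((4 * theta)^-1 * sqn (v n w)).
Let e n w := noise f srv (fun m => Q (xi k n m w)) (u0 w) (U n w).

Let tau0 : 0 < tau. Proof. by case/andP: tau01. Qed.
Let tau1 : 0 < 1 - tau. Proof. by rewrite subr_gt0; case/andP: tau01. Qed.
Let p0 : 0 < p. Proof. by case/andP: p01. Qed.
Let p1 : 0 < 1 - p. Proof. by rewrite subr_gt0; case/andP: p01. Qed.
Let m0 : 0 < 1 + mu * alpha. Proof. by rewrite ltr_pwDl// mulr_ge0 ?ltW. Qed.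
Let h_breg := hdiff_bregman srv f_diff delta0 f_related theta0 theta_delta.

(* The map r serves to put coarser sigma-algebras on the sample space. *)
Let U_meas {d'} {T' : measurableType d'} (r : T' -> T) n :
  (forall i m, (i < n)%N -> measurable_fun setT (xi k i m \o r)) ->
  vmeasurable (y \o r) -> vmeasurable (z \o r) -> vmeasurable (U n \o r).
Proof.
move=> mxi my mz.
apply: (@vmeasurable_epoch _ _ _ _ srv _ _ _ f_diff delta0 f_related mu0 f_convex theta0
  theta_delta _ _ _ _ _ Q_compr _ T' (fun i m => xi k i m \o r) (u0 \o r)) => //.
by apply: vmeasurableD; exact: vmeasurableZ.
Qed.

Lemma U_seed n j m : (n <= j)%N -> vmeasurable (U n : omitting (inl (k, j, m)) -> 'rV[R]_d).
Proof.
move=> nj; apply: (U_meas (T' := omitting (inl (k, j, m))) (r := id)) => // i m' lin.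
apply: seed_omitting; apply/eqP => -[ij _].
by move: (leq_trans lin nj); rewrite ij ltnn.
Qed.

Lemma U_length n : vmeasurable (U n : omitting (inr k) -> 'rV[R]_d).
Proof.
apply: (U_meas (T' := omitting (inr k)) (r := id)) => // i m' lin.
exact: seed_omitting.
Qed.

Lemma u0_seed j m : vmeasurable (u0 : omitting (inl (k, j, m)) -> 'rV[R]_d).
Proof. by apply: vmeasurableD; apply: vmeasurableZ; [exact: z_seed|exact: y_seed]. Qed.

(** The averaging over the nodes gains the factor [1 / M] because their errors
    are uncorrelated. *)
Lemma noise_bound n (c : R) (g : T -> 'rV[R]_d) :
  (forall m, vmeasurable (g : omitting (inl (k, n, m)) -> 'rV[R]_d)) ->
  ('E_P[fun w => sqn (e n w + c *: g w)%R]
   <= 'E_P[fun w => (c ^+ 2 * sqn (g w) + p / (16 * theta ^+ 2) * B n w)%R])%E.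
Proof.
move=> mg.
have mdrift m m' : vmeasurable
    ((fun w => drift f srv (u0 w) (U n w) m') : omitting (inl (k, n, m)) -> 'rV[R]_d).
  by apply: vmeasurable_drift => //; [exact: u0_seed|exact: U_seed].
have := @sqr_noise_nodes _ _ _ _ _ PS _ _ P xi N xi_law indep Q omega Q_compr omega0 k n
  (fun w => c *: g w) (fun m w => drift f srv (u0 w) (U n w) m) M%:R^-1
  (index_enum 'I_M) (index_enum_uniq _) (fun m => vmeasurableZ c (mg m)) mdrift.
have -> : (fun w => sqn (c *: g w + M%:R^-1 *: \sum_(m < M)
   (Q (xi k n m w) (drift f srv (u0 w) (U n w) m) - drift f srv (u0 w) (U n w) m))) =
   (fun w => sqn (e n w + c *: g w)).
  by apply/funext => w; rewrite addrC.
move/le_trans; apply.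
have M0 : (0 < M)%N := leq_ltn_trans (leq0n _) (ltn_ord srv).
have mU : vmeasurable (U n) by exact: vmeasurable_omitting (@U_length n).
have mu0' : vmeasurable u0.
  by apply: vmeasurable_omitting (@u0_seed 0%N (Ordinal M0)).
have mgT : vmeasurable g by exact: vmeasurable_omitting (mg (Ordinal M0)).
apply: ge0_expectation_le.
- apply: measurable_funD; first by apply: measurable_dotv; exact: vmeasurableZ.
  apply: measurable_sum => m; apply: measurable_funM; first exact: measurable_cst.
  apply: measurable_funM; first exact: measurable_cst.
  by apply: measurable_dotv; exact: vmeasurable_omitting (mdrift m m).
- apply: measurable_funD; apply: measurable_funM; try exact: measurable_cst.
    exact: measurable_dotv.
  by apply: measurable_dotv; exact: vmeasurableB.
- move=> w; rewrite addr_ge0 ?dotvv_ge0// sumr_ge0// => m _.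
  by rewrite mulr_ge0 ?sqr_ge0// mulr_ge0 ?dotvv_ge0.
move=> w; rewrite dotvZl dotvZr mulrA -expr2 lerD2l.
apply: (@le_trans _ _ (\sum_(m < M) M%:R^-1 ^+ 2 * (omega * (4 * delta ^+ 2 * B n w)))).
  apply: ler_sum => m _; rewrite ler_wpM2l ?sqr_ge0// ler_wpM2l//.
  exact: (drift_sqr srv f_diff f_related).
rewrite sumr_const card_ord -[leLHS]mulr_natl.
have Mr : M%:R != 0 :> R by rewrite pnatr_eq0 -lt0n.
have -> : M%:R * (M%:R^-1 ^+ 2 * (omega * (4 * delta ^+ 2 * B n w))) =
  4 * delta ^+ 2 * omega / M%:R * B n w by field.
by rewrite ler_wpM2r// /B dotvv_ge0.
Qed.

Let kap0 : 0 < alpha / tau. Proof. by rewrite divr_gt0. Qed.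

Let mU n : vmeasurable (U n).
Proof. exact: vmeasurable_omitting (@U_length n). Qed.
Let my : vmeasurable y. Proof. exact: vmeasurable_omitting y_length. Qed.
Let mz : vmeasurable z. Proof. exact: vmeasurable_omitting z_length. Qed.
Let mu0T : vmeasurable u0. Proof. by apply: vmeasurableD; exact: vmeasurableZ. Qed.

Let mv n : vmeasurable (v n).
Proof.
apply: vmeasurableB => //; apply: vmeasurableD; first exact: vmeasurable_cst.
exact: vmeasurableZ.
Qed.

Let me n : vmeasurable (e n).
Proof.
apply: vmeasurableZ; apply: vmeasurable_sum => m _.
apply: vmeasurableB; last exact: vmeasurable_drift.
by apply: (compressor_vmeasurable Q_compr) => //; exact: vmeasurable_drift.
Qed.

Lemma measurable_rbreg (a b : T -> 'rV[R]_d) : vmeasurable a -> vmeasurable b ->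
  measurable_fun setT (fun w => rbreg theta h (a w) (b w)).
Proof.
move=> ma mb; apply: measurable_funD.
  apply: measurable_funM; first exact: measurable_cst.
  by apply: measurable_dotv; exact: vmeasurableB.
apply: measurable_funB.
  by apply: measurable_funB;
    [apply: (vmeasurable_scalar ma)|apply: (vmeasurable_scalar mb)]; exact: continuous_hdiff.
by apply: measurable_dotv; [exact: vmeasurable_grad_hdiff|exact: vmeasurableB].
Qed.

Let mA n : measurable_fun setT (A n).
Proof.
apply: measurable_funM; first exact: measurable_cst.
apply: measurable_funD; apply: measurable_funM; try exact: measurable_cst.
  by apply: measurable_rbreg => //; exact: vmeasurable_cst.
exact: measurable_rbreg.
Qed.

Let mB n : measurable_fun setT (B n).
Proof. by apply: measurable_dotv; exact: vmeasurableB. Qed.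

Let mV n : measurable_fun setT (V n).
Proof.
by do 2 (apply: measurable_funM; first exact: measurable_cst); exact: measurable_dotv.
Qed.

Lemma measurable_lyap {d'} {T' : measurableType d'} (u a b : T' -> 'rV[R]_d) :
  vmeasurable u -> vmeasurable a -> vmeasurable b ->
  measurable_fun setT (fun w => alpha / tau * (favg (u w) - favg xs)
    + (1 + mu * alpha) / 2 * sqn (z_next mu alpha (p *: (
        rgrad theta h (tau *: b w + (1 - tau) *: a w) - rgrad theta h (u w))) (u w) (b w) - xs)).
Proof.
move=> mu' ma mb.
have mgr (c : T' -> 'rV[R]_d) : vmeasurable c -> vmeasurable (fun w => rgrad theta h (c w)).
  move=> mc; apply: vmeasurableD; first exact: vmeasurableZ.
  exact: vmeasurable_grad_hdiff.
apply: measurable_funD; apply: measurable_funM; try exact: measurable_cst.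
  apply: measurable_funB; last exact: measurable_cst.
  by apply: (vmeasurable_scalar mu'); exact: continuous_avg.
apply: measurable_dotv; (apply: vmeasurableB; last exact: vmeasurable_cst);
  (apply: vmeasurableZ; apply: vmeasurableD; last exact: vmeasurableZ);
  (apply: vmeasurableB => //; apply: vmeasurableZ; apply: vmeasurableZ);
  (apply: vmeasurableB; apply: mgr => //; apply: vmeasurableD; exact: vmeasurableZ).
Qed.

Let mlyap n : measurable_fun setT (lyap n).
Proof. exact: measurable_lyap. Qed.

Let mlyap0 : measurable_fun setT lyap0.
Proof.
apply: measurable_funD; do 2 (apply: measurable_funM; first exact: measurable_cst).
  apply: measurable_funB; last exact: measurable_cst.
  by apply: (vmeasurable_scalar my); exact: continuous_avg.
by apply: measurable_dotv; apply: vmeasurableB => //; exact: vmeasurable_cst.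
Qed.

Let A_ge0 n w : 0 <= A n w.
Proof.
have rb := rbreg_ge0 theta0 h_breg.
apply: mulr_ge0; first exact: ltW.
by apply: addr_ge0; apply: mulr_ge0; rewrite ?rb// ltW.
Qed.

Let B_ge0 n w : 0 <= B n w. Proof. exact: dotvv_ge0. Qed.

Let V_ge0 n w : 0 <= V n w.
Proof. by rewrite mulr_ge0 ?(ltW kap0)// mulr_ge0 ?dotvv_ge0// invr_ge0 mulr_ge0 ?ltW. Qed.

Let lyap_ge0 n w : 0 <= lyap n w.
Proof.
rewrite addr_ge0// mulr_ge0 ?dotvv_ge0 ?(ltW kap0) ?subr_ge0//.
by rewrite divr_ge0// ltW.
Qed.

Let lyap0_ge0 w : 0 <= lyap0 w.
Proof.
rewrite addr_ge0// mulr_ge0 ?(ltW tau1)//.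
  by rewrite mulr_ge0 ?(ltW kap0) ?subr_ge0.
  by rewrite invr_ge0 ltW.
by rewrite mulr_ge0 ?dotvv_ge0// divr_ge0// ltW.
Qed.

(* The coefficient of the squared distances to the starting point of the epoch,
   p / (16 theta) in the scale of the Lyapunov function. *)
Let beta := alpha / tau * (p / (16 * theta)).

Let beta0 : 0 < beta.
Proof. by rewrite mulr_gt0// divr_gt0// mulr_gt0. Qed.

Let pathwise_step n w :
  lyap n.+1 w + (1 - p) * A n.+1 w + p * A 0%N w + beta * B n.+1 w + V n w <=
  lyap0 w + A n w + alpha / tau * (theta * sqn (e n w + (2 * theta)^-1 *: v n w)).
Proof.
have eqn := epoch_step_eqn srv f_diff delta0 f_related mu0 f_convex theta0 theta_delta
   (fun m => Q (xi k n m w)) (u0 w) (U n w).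
have scale (L q a b c L' a' t : R) :
    tau / alpha * L + q + a + b + c <= tau / alpha * L' + a' + t ->
    L + alpha / tau * q + alpha / tau * a + alpha / tau * b + alpha / tau * c
    <= L' + alpha / tau * a' + alpha / tau * t.
  have cancel X : alpha / tau * (tau / alpha * X) = X by field; rewrite !gt_eqF.
  by move=> /(ler_wpM2l (ltW kap0)); rewrite !mulrDr !cancel.
have H := scale _ _ _ _ _ _ _ _
  (epoch_inequality theta0 mu0 f_convex h_breg xs (y w) (z w) tau01 p01 alpha0 alpha_le eqn).
have E1 : (1 - p) * A n.+1 w =
  alpha / tau * ((1 - p) * pot h theta tau xs (y w) (U n.+1 w)) by rewrite /A mulrCA.
have E2 : p * A 0%N w = alpha / tau * (p * pot h theta tau xs (y w) (u0 w)).
  by rewrite /A mulrCA.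
have E3 : beta * B n.+1 w = alpha / tau * (p / (16 * theta) * B n.+1 w).
  by rewrite /beta; exact: esym (mulrA _ _ _).
rewrite E1 E2 E3; exact: H.
Qed.

Local Open Scope ereal_scope.

(* Every term is a nonnegative measurable function, so the expectation splits
   without integrability.  The square of the noise is replaced by its bound,
   which consists of V n and of beta times B n. *)
Let expected_step n :
  'E_P[lyap n.+1] + (1 - p)%:E * 'E_P[A n.+1] + p%:E * 'E_P[A 0%N]
    + beta%:E * 'E_P[B n.+1] + 'E_P[V n] <=
  'E_P[lyap0] + 'E_P[A n] + beta%:E * 'E_P[B n] + 'E_P[V n].
Proof.
have mM (r : R) (g : T -> R) : measurable_fun setT g -> measurable_fun setT (fun w => r * g w)%R.
  by move=> mg; apply: measurable_funM => //; exact: measurable_cst.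
have g0 (r : R) (g : T -> R) : (0 < r)%R -> (forall w, 0 <= g w)%R -> forall w, (0 <= r * g w)%R.
  by move=> r0 gg w; rewrite mulr_ge0// ltW.
have mD (g1 g2 : T -> R) : measurable_fun setT g1 -> measurable_fun setT g2 ->
  measurable_fun setT (fun w => g1 w + g2 w)%R by exact: measurable_funD.
have gD (g1 g2 : T -> R) : (forall w, 0 <= g1 w)%R -> (forall w, 0 <= g2 w)%R ->
  forall w, (0 <= g1 w + g2 w)%R by move=> h1 h2 w; rewrite addr_ge0.
pose err w := sqn (e n w + (2 * theta)^-1 *: v n w).
have merr : measurable_fun setT err.
  by apply: measurable_dotv; apply: vmeasurableD => //; exact: vmeasurableZ.
have err0 w : (0 <= err w)%R by exact: dotvv_ge0.
pose L1 w := (lyap n.+1 w + (1 - p) * A n.+1 w)%R.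
pose L2 w := (L1 w + p * A 0%N w)%R.
pose L3 w := (L2 w + beta * B n.+1 w)%R.
pose L4 w := (L3 w + V n w)%R.
pose R1 w := (lyap0 w + A n w)%R.
pose R2 w := (R1 w + alpha / tau * (theta * err w))%R.
have mL1 : measurable_fun setT L1 by apply: mD => //; exact: mM.
have L1_0 : forall w, (0 <= L1 w)%R by apply: gD => //; exact: g0.
have mL2 : measurable_fun setT L2 by apply: mD => //; exact: mM.
have L2_0 : forall w, (0 <= L2 w)%R by apply: gD => //; exact: g0.
have mL3 : measurable_fun setT L3 by apply: mD => //; exact: mM.
have L3_0 : forall w, (0 <= L3 w)%R by apply: gD => //; exact: g0.
have mR1 : measurable_fun setT R1 by exact: mD.
have R1_0 : forall w, (0 <= R1 w)%R by exact: gD.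
have mR2 : measurable_fun setT R2 by exact: (mD _ _ mR1 (mM _ _ (mM _ _ merr))).
have LE : 'E_P[L4] = 'E_P[lyap n.+1] + (1 - p)%:E * 'E_P[A n.+1] + p%:E * 'E_P[A 0%N]
    + beta%:E * 'E_P[B n.+1] + 'E_P[V n].
  rewrite (ge0_expectationD P mL3 (mV n) L3_0 (V_ge0 n)).
  rewrite (ge0_expectationD P mL2 (mM _ _ (mB n.+1)) L2_0 (g0 _ _ beta0 (B_ge0 n.+1))).
  rewrite (ge0_expectationD P mL1 (mM _ _ (mA 0%N)) L1_0 (g0 _ _ p0 (A_ge0 0%N))).
  rewrite (ge0_expectationD P (mlyap n.+1) (mM _ _ (mA n.+1)) (lyap_ge0 n.+1)
    (g0 _ _ p1 (A_ge0 n.+1))).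
  rewrite (ge0_expectationZl P (ltW p1) (mA n.+1) (A_ge0 n.+1)).
  rewrite (ge0_expectationZl P (ltW p0) (mA 0%N) (A_ge0 0%N)).
  by rewrite (ge0_expectationZl P (ltW beta0) (mB n.+1) (B_ge0 n.+1)).
have RE : 'E_P[R2] = 'E_P[lyap0] + 'E_P[A n] + (alpha / tau)%:E * (theta%:E * 'E_P[err]).
  rewrite (ge0_expectationD P mR1 (mM _ _ (mM _ _ merr)) R1_0 (g0 _ _ kap0 (g0 _ _ theta0 err0))).
  rewrite (ge0_expectationD P mlyap0 (mA n) lyap0_ge0 (A_ge0 n)).
  rewrite (ge0_expectationZl P (ltW kap0) (mM _ _ merr) (g0 _ _ theta0 err0)).
  by rewrite (ge0_expectationZl P (ltW theta0) merr err0).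
rewrite -LE; apply: (@le_trans _ _ 'E_P[R2]).
  apply: ge0_expectation_le => //; first exact: mD.
  - by move=> w; apply: addr_ge0; [exact: L3_0|exact: V_ge0].
  - by move=> w; exact: pathwise_step.
have v_seed m : vmeasurable (v n : omitting (inl (k, n, m)) -> 'rV[R]_d).
  apply: vmeasurableB; last exact: U_seed.
  by apply: vmeasurableD; [exact: vmeasurable_cst|apply: vmeasurableZ; exact: y_seed].
rewrite RE -!addeA leeD2l// leeD2l//.
have msv : measurable_fun setT (fun w => sqn (v n w)) by exact: measurable_dotv.
have sv0 w : (0 <= sqn (v n w))%R by exact: dotvv_ge0.
have := noise_bound (2 * theta)^-1 v_seed.
have c1 : (0 < (2 * theta)^-1 ^+ 2)%R by rewrite exprn_gt0// invr_gt0 mulr_gt0.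
have c2 : (0 < p / (16 * theta ^+ 2))%R by rewrite divr_gt0// mulr_gt0// exprn_gt0.
rewrite (ge0_expectationD P (mM _ _ msv) (mM _ _ (mB n)) (g0 _ _ c1 sv0) (g0 _ _ c2 (B_ge0 n))).
rewrite (ge0_expectationZl P (ltW c1) msv sv0) (ge0_expectationZl P (ltW c2) (mB n) (B_ge0 n)).
move=> nb.
have EV : 'E_P[V n] = (alpha / tau)%:E * (theta%:E * (((2 * theta)^-1 ^+ 2)%:E * 'E_P[fun w => sqn (v n w)])).
  have c4 : (0 < (4 * theta)^-1)%R by rewrite invr_gt0 mulr_gt0.
  rewrite (ge0_expectationZl P (ltW kap0) (mM _ _ msv) (g0 _ _ c4 sv0)).
  rewrite (ge0_expectationZl P (ltW c4) msv sv0).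
  have -> : ((4 * theta)^-1 = theta * (2 * theta)^-1 ^+ 2)%R by field; rewrite gt_eqF.
  by rewrite (EFinM theta) -muleA.
have EB : beta%:E * 'E_P[B n] =
    (alpha / tau)%:E * (theta%:E * ((p / (16 * theta ^+ 2))%:E * 'E_P[B n])).
  rewrite !muleA -!EFinM; congr (_%:E * _); rewrite /beta; field.
  by rewrite !gt_eqF.
have nn0 (r : R) (g : T -> R) : (0 < r)%R -> (forall w, 0 <= g w)%R -> 0 <= r%:E * 'E_P[g].
  by move=> r0 gg; rewrite mule_ge0 ?expectation_ge0// lee_fin ltW.
have x0 := nn0 _ _ c1 sv0; have y0 := nn0 _ _ c2 (B_ge0 n).
have th0 : 0 <= theta%:E by rewrite lee_fin ltW.
have k0 : 0 <= (alpha / tau)%:E by rewrite lee_fin ltW.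
rewrite EV EB addeC -(ge0_muleDr _ (mule_ge0 th0 x0) (mule_ge0 th0 y0)).
rewrite -(ge0_muleDr _ x0 y0).
by apply: lee_wpmul2l => //; exact: lee_wpmul2l.
Qed.


(* The square of a convex combination is at most the combination of the squares,
   and those are bounded by the Bregman distances in the potential. *)
Let V_le_A n w : (V n w <= A n w)%R.
Proof.
rewrite ler_pM2l// /pot.
have i1 := rbreg_lb theta0 h_breg xs (U n w); have i2 := rbreg_lb theta0 h_breg (y w) (U n w).
apply: le_trans (lerD (ler_wpM2l (ltW tau0) i1) (ler_wpM2l (ltW tau1) i2)).
rewrite mulrCA (mulrCA (1 - tau)%R) -mulrDr ler_wpM2l//.
  by rewrite invr_ge0 ltW// mulr_gt0.
have -> : v n w = (tau *: (xs - U n w) + (1 - tau) *: (y w - U n w))%R.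
  by rewrite /v; apply/rowP => i; rewrite !mxE; ring.
move: (xs - U n w)%R (y w - U n w)%R => a b.
have t01 : (0 <= tau * (1 - tau))%R by rewrite mulr_ge0 ?ltW.
have := mulr_ge0 t01 (dotvv_ge0 (a - b)).
by rewrite !dotvE (dotvC b a); lra.
Qed.

(* Strong convexity is applied at the midpoint of y and xs, where the linear terms
   of the two inequalities cancel; minimality bounds the midpoint value below. *)
Let quadratic_growth w : (mu / 4 * sqn (y w - xs) <= favg (y w) - favg xs)%R.
Proof.
pose c := (1 / 2 *: (y w + xs))%R.
have := f_convex (y w) c; have := f_convex xs c; have := xs_min c.
have -> : (y w - c = 1 / 2 *: (y w - xs))%R.
  by apply/rowP => i; rewrite !mxE; field.
have -> : (xs - c = - (1 / 2 *: (y w - xs)))%R.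
  by apply/rowP => i; rewrite !mxE; field.
rewrite !enorm2; move: (grad _ _) (y w - xs)%R => g a.
by rewrite !dotvE; lra.
Qed.

(* The recursion starts from a finite potential: the starting point of the epoch
   is a combination of y and z, whose distances to xs are controlled by lyap0. *)
Let A0_bound : exists2 c : R, (0 <= c)%R & forall w, (A 0%N w <= c * lyap0 w)%R.
Proof.
pose X := ((1 - tau) * (alpha / tau) * mu / 4)%R.
have X0 : (0 < X)%R by rewrite divr_gt0// mulr_gt0// mulr_gt0.
pose c := (alpha / tau * (3 / (2 * theta) * (2 + X^-1)))%R.
have c0 : (0 <= c)%R.
  apply: mulr_ge0; first exact: ltW.
  apply: mulr_ge0; first by apply: divr_ge0 => //; apply: mulr_ge0 => //; exact: ltW.
  by apply: addr_ge0 => //; rewrite invr_ge0 ltW.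
exists c => // w.
pose a := (z w - xs)%R; pose b := (y w - xs)%R.
have m1 : (1 + mu * alpha)%R != 0%R by rewrite gt_eqF.
have E : (lyap0 w = (1 - tau) * (alpha / tau * (favg (y w) - favg xs)) + 1 / 2 * sqn a)%R.
  by rewrite /lyap0 -/a; field; rewrite m1 gt_eqF.
have fa : (0 <= favg (y w) - favg xs)%R by rewrite subr_ge0.
have tk : (0 < (1 - tau) * (alpha / tau))%R by rewrite mulr_gt0.
have ha : (sqn a <= 2 * lyap0 w)%R.
  by rewrite E mulrA; have := mulr_ge0 (ltW tk) fa; lra.
have hb : (sqn b <= X^-1 * lyap0 w)%R.
  rewrite ler_pdivlMl// E mulrA.
  have := ler_wpM2l (ltW tk) (quadratic_growth w); rewrite -/b /X.
  by have := dotvv_ge0 a; lra.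
have hp : (pot h theta tau xs (y w) (U 0%N w) <= 3 / (2 * theta) * (sqn a + sqn b))%R.
  rewrite /pot.
  have i1 := rbreg_ub theta0 h_breg xs (U 0%N w); have i2 := rbreg_ub theta0 h_breg (y w) (U 0%N w).
  apply: le_trans (lerD (ler_wpM2l (ltW tau0) i1) (ler_wpM2l (ltW tau1) i2)) _.
  have -> : (tau * (3 * ((4 * theta)^-1 * sqn (xs - U 0%N w))) +
    (1 - tau) * (3 * ((4 * theta)^-1 * sqn (y w - U 0%N w))) =
    3 / (2 * theta) * ((tau * sqn (xs - U 0%N w) + (1 - tau) * sqn (y w - U 0%N w)) / 2))%R.
    by field; rewrite gt_eqF.
  rewrite ler_wpM2l//; first by apply: divr_ge0 => //; apply: mulr_ge0 => //; exact: ltW.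
  have -> : (xs - U 0%N w = - (tau *: a + (1 - tau) *: b))%R.
    by rewrite /U /u0 /= /a /b; apply/rowP => i; rewrite !mxE; ring.
  have -> : (y w - U 0%N w = tau *: (b - a))%R.
    by rewrite /U /u0 /= /a /b; apply/rowP => i; rewrite !mxE; ring.
  move: (a) (b) => a' b'.
  have t01 : (0 <= tau * (1 - tau))%R by rewrite mulr_ge0 ?ltW.
  have h1 := mulr_ge0 t01 (dotvv_ge0 (a' - b')).
  have s1 : (sqn (tau *: a' + (1 - tau) *: b') <= sqn a' + sqn b')%R.
    have h2 := mulr_ge0 (ltW tau0) (dotvv_ge0 b').
    have h3 := mulr_ge0 (ltW tau1) (dotvv_ge0 a').
    by move: h1; rewrite !dotvE (dotvC b' a'); lra.
  have s2 : (sqn (tau *: (b' - a')) <= 2 * (sqn a' + sqn b'))%R.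
    have tt : (tau * tau <= 1)%R by have := tau1; move: t01; lra.
    have := ler_wpM2r (dotvv_ge0 (b' - a')) tt.
    have := dotv_sqr_sub b' a'; rewrite dotvZl dotvZr mulrA; lra.
  rewrite dotvNl dotvNr opprK.
  have h4 := ler_wpM2l (ltW tau0) s1; have h5 := ler_wpM2l (ltW tau1) s2.
  have h6 := mulr_ge0 (ltW tau0) (addr_ge0 (dotvv_ge0 a') (dotvv_ge0 b')).
  by lra.
rewrite /A /c -[leRHS]mulrA; apply: ler_wpM2l; first exact: ltW.
apply: le_trans hp _; rewrite -[leRHS]mulrA; apply: ler_wpM2l.
  by apply: divr_ge0 => //; apply: mulr_ge0 => //; exact: ltW.
by rewrite mulrDl; exact: lerD.
Qed.

(* The given masses at the positive lengths add up to one, so length zero, for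
   which nothing is given, is a null event. *)
Let length_mass n : distribution P (N k) [set n] =
  if n is n'.+1 then (p * (1 - p) ^+ n')%:E else 0.
Proof.
case: n => [|n]; last exact: N_law.
have tot : \sum_(n <oo) distribution P (N k) [set n] = 1.
  have <- : distribution P (N k) (\bigcup_n [set n]) = 1.
    rewrite -(@probability_setT _ _ _ (distribution P (N k))); congr (distribution _ _ _).
    by apply/seteqP; split => // n _; exists n.
  rewrite measure_bigcup//; first by apply: eq_eseriesl => n; rewrite in_setT.
  by move=> i j _ _ [x [-> ->]].
have le K : distribution P (N k) [set 0%N] <= ((1 - p) ^+ K)%:E.
  have : \sum_(0 <= n < K.+1) distribution P (N k) [set n] <= 1.
    by rewrite -tot; apply: nneseries_lim_ge.
  rewrite big_nat_recl//=; under eq_bigr do rewrite N_law.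
  have -> : \sum_(0 <= i < K) (p * (1 - p) ^+ i)%:E = (1 - (1 - p) ^+ K)%:E.
    rewrite sumEFin; congr EFin; elim: K => [|K IH].
      by rewrite big_geq// expr0 subrr.
    by rewrite big_nat_recr//= IH exprSr; ring.
  by rewrite -leeBrDr// -EFinB subKr.
apply/eqP; rewrite eq_le measure_ge0 andbT.
have fn : distribution P (N k) [set 0%N] = (fine (distribution P (N k) [set 0%N]))%:E.
  by rewrite fineK// fin_num_measure.
have cq : ((1 - p) ^+ K)%R @[K --> \oo] --> (0 : R)%R.
  by apply: cvg_expr; rewrite ger0_norm ?ltW// ltrBlDr ltrDl.
rewrite fn lee_fin -(cvg_lim (@Rhausdorff R) cq); apply: limr_ge.
  by apply/cvg_ex; exists 0%R.
by apply: nearW => K; rewrite -lee_fin -fn.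
Qed.

(** The sample space is split according to the epoch length.  On the event of
    length [n] the new Lyapunov value is [lyap n], which does not depend on the
    length, so the event contributes its probability as a factor. *)
Lemma epoch_expectation :
  'E_P[fun w => lyap (N k w) w] <= 'E_P[lyap0].
Proof.
have [oo|fin] := eqVneq 'E_P[lyap0] +oo; first by rewrite oo leey.
have E0 : 0 <= 'E_P[lyap0] by exact: expectation_ge0.
have Eoo : 'E_P[lyap0] < +oo by rewrite ltey.
have [c c0 Ac] := A0_bound.
have A0oo : 'E_P[A 0%N] < +oo.
  apply: (@le_lt_trans _ _ (c%:E * 'E_P[lyap0])); last by rewrite lte_mul_pinfty// lee_fin.
  rewrite -ge0_expectationZl//; apply: ge0_expectation_le => //.
  by apply: measurable_funM => //; exact: measurable_cst.
have B00 : 'E_P[B 0%N] = 0.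
  have -> : B 0%N = cst 0%R by apply/funext => w; rewrite /B subrr dotv0.
  by rewrite expectation_cst.
have partial := geometric_telescope_ereal p01 beta0 E0 Eoo
  (fun n => expectation_ge0 P (A_ge0 n)) (fun n => expectation_ge0 P (B_ge0 n))
  (fun n => expectation_ge0 P (lyap_ge0 n)) (fun n => expectation_ge0 P (V_ge0 n))
  (fun n => ge0_expectation_le P (mV n) (mA n) (V_ge0 n) (V_le_A n)) A0oo B00 expected_step.
rewrite {1}unlock.
have mNn n : measurable (N k @^-1` [set n]).
  by rewrite -[X in measurable X]setTI; exact: measurable_funP.
have -> : [set: T] = \bigcup_n (N k @^-1` [set n]).
  by apply/seteqP; split => // w _; exists (N k w).
rewrite ge0_integral_bigcup//; first last.
- by move=> i j _ _ [w [/= <- <-]].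
- by move=> w _; rewrite lee_fin.
- apply/measurable_EFinP; apply: measurable_funTS.
  apply: (measurable_lyap (u := fun w => U (N k w) w)) => //.
  by apply: (vmeasurable_stop (u := U)).
have term n : \int[P]_(w in N k @^-1` [set n]) (lyap (N k w) w)%:E =
    distribution P (N k) [set n] * 'E_P[lyap n].
  have mg : measurable_fun setT ((fun w => (lyap n w)%:E) : omitting (inr k) -> \bar R).
    by apply/measurable_EFinP; apply: measurable_lyap => //; exact: U_length.
  have LF := length_freezing indep n mg (fun w => lyap_ge0 n w : 0 <= (lyap n w)%:E).
  rewrite unlock -LF.
  by apply: eq_integral => w; rewrite inE /= => ->.
rewrite (eq_eseriesr (fun n _ => term n)).
apply: lime_le.
  by apply: is_cvg_nneseries => n _ _; rewrite mule_ge0 ?expectation_ge0.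
apply: nearW => -[|K]; first by rewrite big_geq.
rewrite big_nat_recl//= length_mass mul0e add0e big_mkord.
by under eq_bigr do rewrite length_mass; exact: partial.
Qed.

End Epoch.

(** * The contraction of OLGA *)
Theorem theorem1 (R : realType) (d M : nat) (hM : (0 < M)%N)
    (f : 'I_M -> 'rV[R]_d -> R) (delta mu : R) (xs : 'rV[R]_d)
    (dS : measure_display) (S : measurableType dS) (PS : probability S R)
    (Q : S -> 'rV[R]_d -> 'rV[R]_d) (omega p theta tau alpha : R)
    (z0 : 'rV[R]_d)
    (dT : measure_display) (T : measurableType dT) (P : probability T R)
    (xi : nat -> nat -> 'I_M -> {RV P >-> S}) (N : nat -> {RV P >-> nat})
    (f_diff : forall m, twice_differentiable (f m))
    (delta_gt0 : 0 < delta) (f_related : related f delta)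
    (mu_gt0 : 0 < mu) (f_convex : strongly_convex mu (avg f))
    (xs_min : is_argmin (avg f) xs)
    (omega_gt1 : 1 < omega) (Q_compr : unbiased_compressor PS Q omega)
    (p01 : 0 < p < 1) (theta_gt0 : 0 < theta) (tau01 : 0 < tau < 1)
    (alpha_gt0 : 0 < alpha)
    (xi_law : forall k j m, has_law (xi k j m) PS)
    (N_law : forall k, geometric_law (N k) p)
    (indep : mutually_independent P (input_sigma xi N))
    (theta_le : theta <= Num.min
       (Num.sqrt p * Num.sqrt M%:R / (8 * delta * Num.sqrt omega))
       (1 / (2 * delta)))
    (alpha_le : 4 * alpha * p * tau <= theta) :
  let yz k w := olga f (Ordinal hM) (fun k j m => Q (xi k j m w))
                  (fun k => N k w) mu p theta tau alpha z0 k in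
  let Y k w := alpha / tau * (avg f (yz k w).1 - avg f xs) in
  let Z k w := (1 + mu * alpha) / 2 * enorm ((yz k w).2 - xs) ^+ 2 in
  forall k, ('E_P[fun w => (Y k.+1 w + Z k.+1 w)%R]
    <= 'E_P[fun w => ((1 - tau) * Y k w + (1 + mu * alpha)^-1 * Z k w)%R])%E.
Proof.
move=> yz Y Z k.
pose srv : 'I_M := Ordinal hM.
have delta_ne0 : delta != 0 by rewrite gt_eqF.
have omega0 : 0 < omega by exact: lt_trans ltr01 omega_gt1.
have M0 : 0 < M%:R :> R by rewrite ltr0n.
have p0 : 0 < p by case/andP: p01.
move: theta_le; rewrite le_min => /andP[th1 th2].
have theta_delta : 2 * delta * theta <= 1.
  by move: th2; rewrite ler_pdivlMr ?mulr_gt0// mulrC.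
(* The first bound on theta, squared. *)
have noise_le : 4 * delta ^+ 2 * omega / M%:R <= p / (16 * theta ^+ 2).
  move: th1; rewrite ler_pdivlMr; last by rewrite !mulr_gt0// sqrtr_gt0.
  set l := theta * _ => th1.
  have l0 : 0 <= l by rewrite mulr_ge0 ?mulr_ge0 ?sqrtr_ge0 ?ltW.
  have : l ^+ 2 <= (Num.sqrt p * Num.sqrt M%:R) ^+ 2.
    by rewrite ler_sqr ?nnegrE// mulr_ge0 ?sqrtr_ge0.
  rewrite /l !exprMn (sqr_sqrtr (ltW omega0)) (sqr_sqrtr (ltW p0)) (sqr_sqrtr (ltW M0)) => sq.
  rewrite ler_pdivrMr// [leRHS]mulrAC ler_pdivlMr; last by rewrite mulr_gt0// exprn_gt0.
  by move: sq; lra.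
have seed_ne l j j' m m' : (l < k)%N ->
    (inl (l, j', m') : input_index) != (inl (k, j, m) : @input_index M).
  by move=> lk; apply/eqP => -[lk' _ _]; rewrite lk' ltnn in lk.
have len_ne l : (l < k)%N -> (inr l : @input_index M) != (inr k : @input_index M).
  by move=> lk; apply/eqP => -[lk']; rewrite lk' ltnn in lk.
have hist (i : @input_index M) :
    (forall l j m, (l < k)%N -> inl (l, j, m) != i) -> (forall l, (l < k)%N -> inr l != i) ->
    vmeasurable ((fun w => (yz k w).1)
      : g_sigma_algebraType (others (input_sigma xi N : @input_index M -> set_system T) i) -> 'rV[R]_d) /\
    vmeasurable ((fun w => (yz k w).2)
      : g_sigma_algebraType (others (input_sigma xi N : @input_index M -> set_system T) i) -> 'rV[R]_d).
  move=> hs hl.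
  apply: (@vmeasurable_olga _ _ _ f srv delta mu theta f_diff delta_gt0 f_related mu_gt0 f_convex
    theta_gt0 theta_delta _ _ PS Q omega Q_compr _
    (g_sigma_algebraType (others (input_sigma xi N : @input_index M -> set_system T) i))
    (fun l j m w => xi l j m w) (fun l w => N l w)) => //.
  - by move=> l j m lk; apply: seed_omitting; exact: hs.
  - by move=> l lk; apply: length_omitting; exact: hl.
have hist_seed j m := hist (inl (k, j, m)) (fun l j' m' lk => seed_ne l j j' m m' lk)
  (fun l _ => isT).
have hist_len := hist (inr k) (fun l j m _ => isT) len_ne.
have := @epoch_expectation R d M f srv delta mu theta p tau alpha omega xs f_diff delta_gt0
  f_related mu_gt0 f_convex xs_min theta_gt0 theta_delta p01 tau01 alpha_gt0 alpha_le
  (ltW omega0) noise_le _ _ PS _ _ P xi N xi_law N_law indep Q Q_compr k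
  (fun w => (yz k w).1) (fun w => (yz k w).2) (fun j m => (hist_seed j m).1)
  (fun j m => (hist_seed j m).2) hist_len.1 hist_len.2.
cbv zeta => ineq.
have eqE (g h : T -> R) : g =1 h -> ('E_P[g] <= 'E_P[h])%E by move=> /funext ->.
apply: le_trans (eqE _ _ _) (le_trans ineq (eqE _ _ _)) => w.
- by rewrite /Y /Z /yz olga_succ//= enorm2.
- by rewrite /Y /Z enorm2.
Qed.
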